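(* Let $q=p^e$ be a power of a prime $p$, let $d\geq 3$ be an odd integer with $q\equiv 1 \pmod{2d(d-1)}$, and let $a,b\in\mathbb{F}_q^\times$. Let $N_d=\#\{(x,y)\in\mathbb{F}_q^2 : y^2=x^d+ax+b\}$. Let $T$ be a fixed generator of $\widehat{\mathbb{F}_q^\times}$, and put $\psi=T^{\frac{q-1}{2(d-1)}}$ (order $2(d-1)$) and $\xi=T^{\frac{q-1}{2d(d-1)}}$ (order $2d(d-1)$). Let $\alpha=\dfrac{d}{a}\left(\dfrac{db}{a(d-1)}\right)^{d-1}$. Then $$N_d=q+\phi(b)-\phi(-b(d-1))\,T^{\frac{q-1}{4}}(-1)+q^{\frac{d-1}{2}}\phi(-b(d-1))\,T^{\frac{q-1}{4}}(-1)\,T^{\frac{q-1}{2(d-1)}}\!\left(-\frac1\alpha\right)\,{}_{d-1}F_{d-2}\!\left(\begin{array}{c}A_0,A_1,\ldots,A_{d-2}\\ B_1,\ldots,B_{d-2}\end{array}\Big|\ -\alpha\right),$$ where $A_0=\xi^{d-2}$ and, for $k=2,\ldots,d-1$, $A_{k-1}=\xi^{2k(d-1)-d}$ and $B_{k-1}=\psi^{2k-2}$; i.e. the top row is $\xi^{d-2},\xi^{3d-4},\ldots,\xi^{d^2-3d+1},\xi^{d^2-d-1},\ldots,\xi^{2d^2-5d+2}$ and the bottom row is $\psi^2,\psi^4,\ldots,\psi^{2d-4}$.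
   Context: $\widehat{\mathbb{F}_q^\times}$ denotes the group of multiplicative characters of $\mathbb{F}_q^\times$; every character (including the trivial one) is extended to $\mathbb{F}_q$ by setting $\chi(0)=0$. $\varepsilon$ is the trivial character and $\phi$ the quadratic character. For characters $A,B$, $\overline{B}$ is the inverse of $B$ and $${A\choose B}:=\frac{B(-1)}{q}\sum_{x\in\mathbb{F}_q}A(x)\overline{B}(1-x).$$ For characters $A_0,\ldots,A_n,B_1,\ldots,B_n$ and $x\in\mathbb{F}_q$, the Gaussian hypergeometric series is $${}_{n+1}F_n\!\left(\begin{array}{c}A_0,A_1,\ldots,A_n\\ B_1,\ldots,B_n\end{array}\Big|\ x\right):=\frac{q}{q-1}\sum_{\chi}{A_0\chi\choose\chi}{A_1\chi\choose B_1\chi}\cdots{A_n\chi\choose B_n\chi}\chi(x),$$ the sum over all multiplicative characters $\chi$ of $\mathbb{F}_q$. *)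

(* Defs.v *)
From HB Require Import structures.
From mathcomp Require Import all_boot all_order all_algebra all_fingroup all_solvable all_field all_character.
Set Implicit Arguments. Unset Strict Implicit. Unset Printing Implicit Defensive.
Import Order.TTheory GRing.Theory Num.Theory.
Local Open Scope ring_scope.

(* Multiplicative characters of F_q^x are the (linear = irreducible) characters
   of the abelian finite group {unit F}; they live in 'CF(UG F). *)
Definition UG (F : finFieldType) := [set: {unit F}]%G.

Definition ext (F : finFieldType) (chi : 'CF(UG F)) (x : F) : algC :=
  if insub x is Some u then chi u else 0.

Definition qchar (F : finFieldType) (x : F) : algC :=
  if x == 0 then 0 else if [exists y : F, y ^+ 2 == x] then 1 else -1.

Definition gbinom (F : finFieldType) (A B : 'CF(UG F)) : algC :=
  ext B (-1) / (#|F|%:R) * \sum_(x : F) ext A x * ext (B^-1) (1 - x).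

Definition ghyp (F : finFieldType) (n : nat) (A B : nat -> 'CF(UG F)) (x : F)
  : algC :=
  (#|F|%:R / (#|F|.-1)%:R) *
  \sum_(i : Iirr (UG F))
     (gbinom (A 0%N * 'chi_i) 'chi_i *
      \prod_(1 <= k < n.+1) gbinom (A k * 'chi_i) (B k * 'chi_i)) * ext 'chi_i x.

Definition Npts (F : finFieldType) (d : nat) (a b : F) : nat :=
  #|[set xy : F * F | xy.2 ^+ 2 == xy.1 ^+ d + a * xy.1 + b]|.

(* Main.v *)
(** Writing the number of points as q plus a sum of quadratic characters and
    expanding that sum over the multiplicative characters lam turns it into a sum
    of products of three Gauss sums, g(phi lam^(1-d)) g(lam^d) g(lam^-1).  The
    product formula of Hasse and Davenport for m = d and m = d - 1 splits
    g(lam^d) and g(phi lam^(1-d)) into products over the characters of order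
    dividing d and d - 1; paired off, these are the Jacobi sums in the
    hypergeometric series.  The trivial lam is exceptional, since its Gauss sum
    has absolute value 1 instead of the square root of q, and it accounts for
    the correction term.

    The Hasse-Davenport formula comes from the L-functions sum_f w(f) T^(deg f)
    over monic polynomials f, with
    w(f) = chi(product of the roots) theta(sum of the m-th powers of the roots).
    The recursion n c_n = sum_(1 <= j <= n) S_j c_(n-j) ties the coefficients c_n to
    the sums S_j of w over the characteristic polynomials of the elements of
    F_(q^j).  For m = 1 the L-function is 1 + g(chi) T, hence S_j = - (- g(chi))^j.
    For general m and with chi^m in place of chi, counting m-th roots in F_(q^j)
    shows that S_j is the sum of the S_j attached to the m twists of chi by
    characters of order dividing m, so c_m is the product of their Gauss sums;
    on the other hand the m-th power sum is affine in the constant term of a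
    polynomial of degree m, so c_m is g(chi^m) chi(m)^(-m) times a factor that does
    not depend on chi. *)

Require Import Defs.
From HB Require Import structures.
From mathcomp Require Import all_boot all_order all_algebra all_fingroup all_solvable all_field all_character.
From mathcomp Require Import zify ring.
Set Implicit Arguments. Unset Strict Implicit. Unset Printing Implicit Defensive.
Import Order.TTheory GRing.Theory Num.Theory.
Local Open Scope ring_scope.

(** * Newton's identities *)

Section NewtonIdentities.
Variable R : comNzRingType.
Implicit Types (r : R) (rs ss : seq R).

Definition power_sum rs n := \sum_(r <- rs) r ^+ n.
Definition signed_esym rs n : R := (\prod_(r <- rs) (1 - r *: 'X))`_n.

Lemma signed_esym_cons r rs n :
  signed_esym (r :: rs) n.+1 = signed_esym rs n.+1 - r * signed_esym rs n.
Proof.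
by rewrite /signed_esym big_cons mulrBl mul1r coefB -scalerAl coefZ coefXM.
Qed.

Lemma signed_esym0 rs : signed_esym rs 0 = 1.
Proof.
elim: rs => [|r rs IHrs]; first by rewrite /signed_esym big_nil coef1.
rewrite /signed_esym big_cons mulrBl mul1r coefB -scalerAl coefZ coefXM /=.
by rewrite mulr0 subr0.
Qed.

Lemma signed_esym_gt_size rs n : (size rs < n)%N -> signed_esym rs n = 0.
Proof.
elim: rs n => [|r rs IHrs] [|n] //= lt_rs_n.
  by rewrite /signed_esym big_nil coef1.
by rewrite signed_esym_cons !IHrs ?mulr0 ?subr0 // ltnW.
Qed.

Lemma coef_prod_XsubC rs n : (n <= size rs)%N ->
  (\prod_(r <- rs) ('X - r%:P))`_(size rs - n) = signed_esym rs n.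
Proof.
elim: rs n => [|r rs IHrs] [|n] //= le_n_rs.
- by rewrite big_nil coef1 signed_esym0.
- rewrite subn0 big_cons mulrBl coefB coefXM coefCM /= signed_esym0.
  rewrite [X in _ - _ * X]nth_default ?size_prod_XsubC // mulr0 subr0.
  by rewrite -(subn0 (size rs)) IHrs ?signed_esym0.
rewrite big_cons mulrBl coefB coefXM coefCM subSS signed_esym_cons (IHrs n) //.
have [lt_n_rs|le_rs_n] := ltnP n (size rs).
  by rewrite subn_eq0 leqNgt lt_n_rs -(IHrs n.+1) // subnS.
have -> : n = size rs by apply/eqP; rewrite eqn_leq le_rs_n andbT.
by rewrite subnn (signed_esym_gt_size (ltnSn _)).
Qed.

Lemma sum_expr_signed_esym_cons r rs n :
  \sum_(j < n.+1) r ^+ j.+1 * signed_esym (r :: rs) (n - j) = r * signed_esym rs n.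
Proof.
elim: n => [|n IHn]; first by rewrite big_ord1 !signed_esym0.
rewrite big_ord_recl subn0 expr1 signed_esym_cons.
under eq_bigr => j _ do rewrite /bump /= subSS exprS -mulrA.
by rewrite -mulr_sumr IHn; ring.
Qed.

Lemma newton_identity rs n :
  n.+1%:R * signed_esym rs n.+1
    = - \sum_(j < n.+1) power_sum rs j.+1 * signed_esym rs (n - j).
Proof.
elim: rs n => [|r rs IHrs] n.
  rewrite signed_esym_gt_size // mulr0 big1 ?oppr0 // => j _.
  by rewrite /power_sum big_nil mul0r.
under eq_bigr => j _ do rewrite /power_sum big_cons mulrDl.
rewrite big_split sum_expr_signed_esym_cons signed_esym_cons mulrBr IHrs /=.
case: n => [|n]; first by rewrite !big_ord1 !signed_esym0 /power_sum; ring.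
rewrite big_ord_recr [X in _ = - (_ + X)]big_ord_recr /= !subnn !signed_esym0.
have -> : \sum_(j < n.+1) power_sum rs j.+1 * signed_esym (r :: rs) (n.+1 - j)
    = \sum_(j < n.+1) power_sum rs j.+1 * signed_esym rs (n.+1 - j)
      + r * (n.+1%:R * signed_esym rs n.+1).
  rewrite IHrs mulrN mulr_sumr -sumrB; apply: eq_bigr => j _.
  by rewrite subSn -1?ltnS // signed_esym_cons; ring.
by rewrite -[n.+2%:R]natr1 /power_sum; ring.
Qed.

Lemma power_sum_newton rs n : power_sum rs n.+1 = - (n.+1%:R * signed_esym rs n.+1)
  - \sum_(j < n) power_sum rs j.+1 * signed_esym rs (n - j).
Proof. by rewrite newton_identity big_ord_recr /= subnn signed_esym0; ring. Qed.

Lemma eq_power_sum rs ss m :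
    (forall n, (n <= m)%N -> signed_esym rs n = signed_esym ss n) ->
  forall n, (n < m)%N -> power_sum rs n.+1 = power_sum ss n.+1.
Proof.
move=> eq_e n; elim/ltn_ind: n => n IHn lt_nm.
rewrite !power_sum_newton eq_e //; congr (_ - _); apply: eq_bigr => j _.
by rewrite IHn ?eq_e ?(ltn_trans _ lt_nm) // (leq_trans (leq_subr _ _)) // ltnW.
Qed.

Lemma power_sum_top rs ss m :
    (forall n, (n <= m)%N -> signed_esym rs n = signed_esym ss n) ->
  power_sum rs m.+1
    = power_sum ss m.+1 - m.+1%:R * (signed_esym rs m.+1 - signed_esym ss m.+1).
Proof.
move=> eq_e; rewrite !power_sum_newton.
have -> : \sum_(j < m) power_sum rs j.+1 * signed_esym rs (m - j) =
          \sum_(j < m) power_sum ss j.+1 * signed_esym ss (m - j).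
  by apply: eq_bigr => j _; rewrite (eq_power_sum eq_e) // eq_e ?leq_subr.
by ring.
Qed.

End NewtonIdentities.

Lemma newton_recursion_unique (R : numDomainType) (rs : seq R) (c : nat -> R) m :
    c 0%N = 1 ->
    (forall n, (n < m)%N ->
       n.+1%:R * c n.+1 = - \sum_(j < n.+1) power_sum rs j.+1 * c (n - j)%N) ->
  forall n, (n <= m)%N -> c n = signed_esym rs n.
Proof.
move=> c0 recursion; elim/ltn_ind => -[|n] IHn le_nm; first by rewrite c0 signed_esym0.
apply: (@mulfI _ n.+1%:R); first by rewrite pnatr_eq0.
rewrite recursion // newton_identity; congr (- _); apply: eq_bigr => j _.
by rewrite IHn ?ltnS ?leq_subr // (leq_trans (leq_subr _ _)) // ltnW.
Qed.

(** * Frobenius orbits and sums over monic polynomials *)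

Lemma big_traject (T R : Type) (idx : R) (op : Monoid.law idx) (f : T -> T)
    (G : T -> R) x n :
  \big[op/idx]_(y <- traject f x n) G y = \big[op/idx]_(i < n) G (iter i f x).
Proof.
elim: n => [|n IHn]; first by rewrite big_nil big_ord0.
by rewrite trajectSr -cats1 big_cat big_seq1 IHn big_ord_recr.
Qed.

Section FrobeniusOrbits.
Variables (F K : finFieldType) (iota : {rmorphism F -> K}) (retr : {additive K -> F}).
Hypothesis iotaK : cancel iota retr.
Implicit Types (f g : {poly F}) (y : K).

Local Notation "f ^iota" := (map_poly iota f) (at level 2, format "f ^iota").

Definition frobenius y := y ^+ #|F|.

Lemma pchar_nat_card : [pchar K].-nat #|F|.
Proof.
have [p pr_p pcharFp] := finPcharP F.
have pcharKp : p \in [pchar K] by rewrite (fmorph_pchar iota).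
rewrite (eq_pnat _ (pcharf_eq pcharKp)) -cardsT.
by have /and3P[] := fin_ring_pchar_abelem pcharFp.
Qed.

Fact frobenius_is_zmod_morphism : zmod_morphism frobenius.
Proof.
move=> x y; apply: (addIr (frobenius y)).
by rewrite /frobenius -exprDn_pchar ?pchar_nat_card // !subrK.
Qed.

Fact frobenius_is_monoid_morphism : monoid_morphism frobenius.
Proof. by split=> [|x y]; rewrite /frobenius ?expr1n ?exprMn. Qed.

HB.instance Definition _ :=
  GRing.isZmodMorphism.Build K K frobenius frobenius_is_zmod_morphism.
HB.instance Definition _ :=
  GRing.isMonoidMorphism.Build K K frobenius frobenius_is_monoid_morphism.

Lemma iter_frobenius i y : iter i frobenius y = y ^+ (#|F| ^ i).
Proof.
elim: i => [|i IHi]; first by rewrite expr1.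
by rewrite iterS IHi /frobenius -exprM -expnSr.
Qed.

Lemma frobenius_iota x : frobenius (iota x) = iota x.
Proof. by rewrite /frobenius -rmorphXn expf_card. Qed.

Lemma frobenius_fixedK y : frobenius y = y -> iota (retr y) = y.
Proof.
move=> fix_y; suff /existsP[x /eqP <-] : [exists x, iota x == y] by rewrite iotaK.
have := congr1 (fun f => f^iota.[y]) (finField_genPoly F).
rewrite rmorphB /= map_polyXn map_polyX !hornerE -/(frobenius y) fix_y subrr.
rewrite rmorph_prod horner_prod => /esym/eqP; rewrite prodf_seq_eq0 => /hasP[x _].
rewrite /= map_polyXsubC hornerXsubC subr_eq0 => /eqP y_eq.
by apply/existsP; exists x; rewrite y_eq.
Qed.

(* For y in the degree j extension of F, that is, [iter j frobenius y = y], the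
   polynomial [char_poly_ext j y] is the characteristic polynomial of y. *)
Definition conj_prod j y := \prod_(z <- traject frobenius y j) ('X - z%:P).
Definition char_poly_ext j y : {poly F} := map_poly retr (conj_prod j y).

Lemma conj_prod_monic j y : conj_prod j y \is monic.
Proof. exact: monic_prod_XsubC. Qed.

Lemma size_conj_prod j y : size (conj_prod j y) = j.+1.
Proof. by rewrite size_prod_XsubC size_traject. Qed.

Lemma conj_prodD i j y : iter i frobenius y = y ->
  conj_prod (i + j) y = conj_prod i y * conj_prod j y.
Proof. by move=> fix_y; rewrite /conj_prod trajectD fix_y big_cat. Qed.

Lemma big_traject_frobenius (R : Type) (idx : R) (op : Monoid.com_law idx)
    (G : K -> R) j y : iter j frobenius y = y ->
  \big[op/idx]_(z <- traject frobenius y j) G (frobenius z)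
    = \big[op/idx]_(z <- traject frobenius y j) G z.
Proof.
case: j => [|j] fix_y; first by rewrite !big_nil.
rewrite !big_traject big_ord_recr [RHS]big_ord_recl /= -iterS fix_y.
by rewrite Monoid.mulmC.
Qed.

Lemma map_char_poly_ext j y : iter j frobenius y = y ->
  (char_poly_ext j y)^iota = conj_prod j y.
Proof.
move=> fix_y; apply/polyP => k; rewrite coef_map coef_map_id0 ?raddf0 //.
apply: frobenius_fixedK; rewrite -coef_map; congr (_ : {poly K})`_k.
rewrite [LHS]rmorph_prod -[RHS](big_traject_frobenius _ _ fix_y).
by apply: eq_bigr => z _; rewrite /= map_polyXsubC.
Qed.

Lemma char_poly_ext_monic j y : iter j frobenius y = y -> char_poly_ext j y \is monic.
Proof.
by move/map_char_poly_ext=> mapE; rewrite -(map_monic iota) mapE conj_prod_monic.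
Qed.

Lemma size_char_poly_ext j y : iter j frobenius y = y -> size (char_poly_ext j y) = j.+1.
Proof.
by move/map_char_poly_ext=> mapE; rewrite -(size_map_poly iota) mapE size_conj_prod.
Qed.

Lemma root_frobenius f y : root f^iota y -> root f^iota (frobenius y).
Proof.
move=> /rootP fy0; apply/rootP.
have -> : f^iota = map_poly frobenius f^iota.
  by rewrite -map_poly_comp; apply: eq_map_poly => x /=; rewrite frobenius_iota.
by rewrite horner_map fy0 rmorph0.
Qed.

Local Notation period := (fingraph.order frobenius).

Lemma iter_period y : iter (period y) frobenius y = y.
Proof. exact/iter_order/fmorph_inj. Qed.

Lemma iter_lt_period i y : (0 < i < period y)%N -> iter i frobenius y != y.
Proof.
case/andP=> i_gt0 lt_i; apply: contraTneq i_gt0 => fix_y.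
by rewrite -(findex_iter lt_i) fix_y findex0.
Qed.

Lemma conj_prod_period_dvdp f y : root f^iota y -> conj_prod (period y) y %| f^iota.
Proof.
move=> root_y; apply: uniq_roots_dvdp; last by rewrite uniq_rootsE orbit_uniq.
apply/allP => _ /trajectP[i _ ->].
by elim: i => //= i; apply: root_frobenius.
Qed.

Lemma mup_conj_prod_period y : mup y (conj_prod (period y) y) = 1%N.
Proof. by rewrite mu_prod_XsubC count_uniq_mem ?orbit_uniq // in_orbit. Qed.

Lemma sum_iter_period y (P : pred nat) :
  (\sum_(i < period y) ((iter i.+1 frobenius y == y) && P i.+1))%N = P (period y).
Proof.
have := orderSpred frobenius y; set e := (period y).-1 => eE.
rewrite -eE big_ord_recr big1 => [|i _]; last first.
  by rewrite (negbTE (iter_lt_period _)) //= -eE ltnS.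
by rewrite [nat_of_ord _]/= eE iter_period eqxx.
Qed.

(* Splitting off the minimal polynomial of y lowers both sides by one. *)
Lemma sum_conj_prod_dvdp f y : f \is monic ->
  (\sum_(j < (size f).-1)
      ((iter j.+1 frobenius y == y) && (conj_prod j.+1 y %| f^iota)%R))%N
    = mup y f^iota.
Proof.
have [n] := ubnP (size f); elim: n f => // n IHn f lt_fn monic_f.
have [root_y|not_root_y] := boolP (root f^iota y); last first.
  rewrite mupNroot // big1 // => j _; case: andP => // -[_ dvd_f].
  case/negP: not_root_y; rewrite -dvdp_XsubCl; apply: dvdp_trans dvd_f.
  by rewrite /conj_prod big_cons dvdp_mulr.
set e := period y; have fix_y : iter e frobenius y = y := iter_period y.
pose P := char_poly_ext e y; have monic_P : P \is monic by apply: char_poly_ext_monic.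
have size_P : size P = e.+1 by apply: size_char_poly_ext.
have mapP : P^iota = conj_prod e y by apply: map_char_poly_ext.
have [g def_f] : exists g, f = P * g.
  exists (f %/ P); apply/eqP; rewrite mulrC -dvdp_eq -(dvdp_map iota) mapP.
  exact: conj_prod_period_dvdp.
have monic_g : g \is monic by rewrite -(monicMl _ monic_P) -def_f.
have g_gt0 : (0 < size g)%N by rewrite size_poly_gt0 monic_neq0.
have size_f : (size f).-1 = (e + (size g).-1)%N.
  by rewrite def_f size_monicM ?monic_neq0 // size_P; lia.
have lt_gn : (size g < n)%N by have := fingraph.order_gt0 frobenius y; lia.
have map_f : f^iota = conj_prod e y * g^iota by rewrite def_f rmorphM /= mapP.
rewrite size_f big_split_ord (sum_iter_period _ (fun j => conj_prod j y %| f^iota)).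
rewrite map_f dvdp_mulr // mupM ?map_poly_eq0 ?monic_neq0 ?conj_prod_monic //.
rewrite mup_conj_prod_period -(IHn g) //; congr addn; apply: eq_bigr => j _.
rewrite [nat_of_ord _]/= -addnS conj_prodD // dvdp_mul2l ?monic_neq0 ?conj_prod_monic //.
by rewrite addnC iterD fix_y.
Qed.

End FrobeniusOrbits.

Section MonicSums.
Variable F : finFieldType.
Implicit Types (f g : {poly F}) (w : {poly F} -> algC).

Definition monic_rVpoly n (c : 'rV[F]_n) : {poly F} := 'X^n + rVpoly c.

Lemma size_rVpoly n (c : 'rV[F]_n) : (size (rVpoly c) <= n)%N.
Proof. exact: size_poly. Qed.

Lemma size_monic_rVpoly n (c : 'rV[F]_n) : size (monic_rVpoly c) = n.+1.
Proof. by rewrite size_polyDl size_polyXn // ltnS size_rVpoly. Qed.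

Lemma monic_rVpoly_monic n (c : 'rV[F]_n) : monic_rVpoly c \is monic.
Proof. by rewrite monicE lead_coefDl ?lead_coefXn // size_polyXn ltnS size_rVpoly. Qed.

Lemma coef_monic_rVpoly n (c : 'rV[F]_n) (i : 'I_n) : (monic_rVpoly c)`_i = c 0 i.
Proof. by rewrite coefD coefXn ltn_eqF // add0r coef_rVpoly_ord. Qed.

Lemma monic_rVpoly_inj n : injective (@monic_rVpoly n).
Proof. by move=> c d /addrI/(can_inj rVpolyK). Qed.

Lemma monic_rVpolyK n f : f \is monic -> size f = n.+1 ->
  monic_rVpoly (poly_rV (f - 'X^n) : 'rV_n) = f.
Proof.
move=> monic_f size_f; rewrite /monic_rVpoly poly_rV_K ?subrKC //.
apply/leq_sizeP => j; rewrite leq_eqVlt => /predU1P[<-|lt_nj].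
  move: monic_f; rewrite monicE lead_coefE size_f => /eqP /= fn.
  by rewrite coefB coefXn eqxx fn subrr.
by rewrite coefB coefXn gtn_eqF // subr0 nth_default ?size_f.
Qed.

Definition sum_monic w n := \sum_(c : 'rV[F]_n) w (monic_rVpoly c).

Definition monic_multiplicative w :=
  {in monic &, {morph w : f g / f * g}}.

Lemma sum_monic_dvdp w n j P : monic_multiplicative w ->
    P \is monic -> size P = j.+1 -> (j <= n)%N ->
  \sum_(c : 'rV[F]_n | P %| monic_rVpoly c) w (monic_rVpoly c)
    = w P * sum_monic w (n - j).
Proof.
move=> wM monic_P size_P le_jn; have P_neq0 := monic_neq0 monic_P.
pose times_P (c : 'rV[F]_(n - j)) : 'rV[F]_n := poly_rV (P * monic_rVpoly c - 'X^n).
pose over_P (c : 'rV[F]_n) : 'rV[F]_(n - j) :=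
  poly_rV (monic_rVpoly c %/ P - 'X^(n - j)).
have times_PE c : monic_rVpoly (times_P c) = P * monic_rVpoly c.
  apply: monic_rVpolyK; first by rewrite monicMl // monic_rVpoly_monic.
  rewrite size_monicM ?monic_neq0 ?monic_rVpoly_monic // size_P size_monic_rVpoly.
  by rewrite addSn /= addnS subnKC.
have over_PK c : P %| monic_rVpoly c -> P * monic_rVpoly (over_P c) = monic_rVpoly c.
  move=> /divpK; rewrite mulrC => divE.
  have monic_div : monic_rVpoly c %/ P \is monic.
    by rewrite -(monicMl _ monic_P) divE monic_rVpoly_monic.
  rewrite monic_rVpolyK //; have := size_monic_rVpoly c.
  rewrite -{1}divE size_monicM ?monic_neq0 // size_P addSn /=.
  by move: (size _); lia.
rewrite /sum_monic mulr_sumr (reindex times_P); last first.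
  exists over_P => c; rewrite !inE => dvd_c.
    by apply: monic_rVpoly_inj; apply: (mulfI P_neq0); rewrite over_PK.
  by apply: monic_rVpoly_inj; rewrite times_PE over_PK.
apply: eq_big => [c|c _]; first by rewrite times_PE dvdp_mulr.
by rewrite times_PE wM ?monic_rVpoly_monic.
Qed.

End MonicSums.

Lemma sum_mup_prod_XsubC (K : finFieldType) (rs : seq K) :
  (\sum_y mup y (\prod_(r <- rs) ('X - r%:P)))%N = size rs.
Proof.
under eq_bigr => y _ do rewrite mu_prod_XsubC.
elim: rs => [|r rs IHrs] /=; first by rewrite big1.
rewrite big_split IHrs (bigD1 r) //= eqxx big1 // => y /negbTE.
by rewrite eq_sym => ->.
Qed.

Definition splits_monic (F K : fieldType) (iota : F -> K) n :=
  forall f : {poly F}, f \is monic -> (size f <= n.+1)%N ->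
    exists rs : seq K, map_poly iota f = \prod_(r <- rs) ('X - r%:P).

(* The logarithmic derivative of the L-function of w: if c_n is the sum of w
   over the monic polynomials of degree n, then T L'(T) = L(T) * sum_j S_j T^j. *)
Section LogarithmicDerivative.
Variables (F K : finFieldType) (iota : {rmorphism F -> K}) (retr : {additive K -> F}).
Hypothesis iotaK : cancel iota retr.
Variable deg_bound : nat.
Hypothesis splits : splits_monic iota deg_bound.

Local Notation frobenius := (@frobenius F K).

Lemma monic_rVpoly_splits n (c : 'rV[F]_n) : (n <= deg_bound)%N ->
  exists2 rs : seq K, size rs = n
    & map_poly iota (monic_rVpoly c) = \prod_(r <- rs) ('X - r%:P).
Proof.
move=> le_n; have [|rs rsE] := splits (monic_rVpoly_monic c).
  by rewrite size_monic_rVpoly ltnS.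
exists rs => //; apply: succn_inj.
by rewrite -(size_prod_XsubC rs id) -rsE size_map_poly size_monic_rVpoly.
Qed.

Definition frobenius_sum (w : {poly F} -> algC) j :=
  \sum_(y : K | iter j frobenius y == y) w (char_poly_ext retr j y).

Lemma natr_sum_char_poly_ext_dvdp n (c : 'rV[F]_n) : (n <= deg_bound)%N ->
  n%:R = \sum_(j < n) \sum_(y : K | iter j.+1 frobenius y == y)
            (char_poly_ext retr j.+1 y %| monic_rVpoly c)%R%:R :> algC.
Proof.
move=> le_n; have [rs size_rs rsE] := monic_rVpoly_splits c le_n.
rewrite -[in LHS]size_rs -sum_mup_prod_XsubC -rsE natr_sum.
under [RHS]eq_bigr => j _ do rewrite big_mkcond.
rewrite exchange_big; apply: eq_bigr => y _ /=.
rewrite -(sum_conj_prod_dvdp iotaK _ (monic_rVpoly_monic c)) size_monic_rVpoly natr_sum.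
apply: eq_bigr => j _; case: eqP => //= fix_y.
by rewrite -(dvdp_map iota) (map_char_poly_ext iotaK).
Qed.

Lemma sum_monic_recursion w n : monic_multiplicative w -> (n < deg_bound)%N ->
  n.+1%:R * sum_monic w n.+1
    = \sum_(j < n.+1) frobenius_sum w j.+1 * sum_monic w (n - j).
Proof.
move=> wM lt_n; rewrite [in LHS]/sum_monic mulr_sumr.
under eq_bigr => c _ do rewrite {1}(natr_sum_char_poly_ext_dvdp c lt_n) mulr_suml.
rewrite exchange_big; apply: eq_bigr => j _ /=.
under eq_bigr => c _ do rewrite mulr_suml.
rewrite exchange_big mulr_suml; apply: eq_bigr => y /eqP fix_y /=.
rewrite -subSS -(sum_monic_dvdp wM) ?(char_poly_ext_monic iotaK) //;
  last exact: size_char_poly_ext.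
by rewrite [RHS]big_mkcond; apply: eq_bigr => c _; case: ifP; rewrite ?mul1r ?mul0r.
Qed.

End LogarithmicDerivative.

(** * Multiplicative characters *)

Lemma oppr1_neq0 (R : nzRingType) : -1 != 0 :> R.
Proof. by rewrite oppr_eq0 oner_eq0. Qed.

Lemma eq_mul_neq1_eq0 (R : idomainType) (c x : R) : x = c * x -> c != 1 -> x = 0.
Proof.
move=> xE c_neq1; apply/eqP; move: xE => /eqP.
by rewrite -subr_eq0 -{1}[x]mul1r -mulrBl mulf_eq0 subr_eq0 eq_sym (negbTE c_neq1).
Qed.

Lemma prim_root_neq0 (R : nzRingType) n (z : R) : n.-primitive_root z -> z != 0.
Proof. by move=> z_prim; rewrite (prim_root_eq0 z_prim) -lt0n (prim_order_gt0 z_prim). Qed.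

Section FiniteFieldUnits.
Variable F : finFieldType.

Lemma pred_card_gt0 : (0 < #|F|.-1)%N.
Proof. by rewrite -subn1 subn_gt0 finNzRing_gt1. Qed.

Lemma card_finField_succ : #|F| = #|F|.-1.+1.
Proof. by rewrite prednK // (ltn_trans _ (finNzRing_gt1 F)). Qed.

Lemma card_finField_neq0 : #|F|%:R != 0 :> algC.
Proof. by rewrite pnatr_eq0 card_finField_succ. Qed.

Lemma expf_pred_card (x : F) : x != 0 -> x ^+ #|F|.-1 = 1.
Proof.
move=> x_neq0; apply: (mulfI x_neq0).
by rewrite -exprS -card_finField_succ expf_card mulr1.
Qed.

Lemma finField_prim_root : exists w : F, #|F|.-1.-primitive_root w.
Proof.
pose units := enum [pred x : F | x != 0].
have units_root : all #|F|.-1.-unity_root units.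
  by apply/allP => x; rewrite mem_enum => /expf_pred_card/unity_rootP.
have size_units : (#|F|.-1 <= size units)%N.
  by rewrite -cardE -(cardC1 (0 : F)); apply/eq_leq/eq_card => x; rewrite !inE.
have /hasP[w] := has_prim_root pred_card_gt0 units_root (enum_uniq _) size_units.
by exists w.
Qed.

Lemma dvdn_pred_card_natf_neq0 m : (m %| #|F|.-1)%N -> m%:R != 0 :> F.
Proof. by have [w w_prim] := finField_prim_root; apply: (prim_root_dvd_eq0 w_prim). Qed.

End FiniteFieldUnits.

Section MultiplicativeCharacters.
Variable F : finFieldType.
Implicit Types (chi psi lam : 'CF(UG F)) (x y : F).

Local Notation N := #|F|.-1.

Lemma abelian_UG : abelian (UG F).
Proof. by apply/centsP => u _ v _; apply/val_inj; apply: mulrC. Qed.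

Lemma irr_UG_lin (i : Iirr (UG F)) : 'chi_i \is a linear_char.
Proof. exact/char_abelianP/abelian_UG. Qed.

Lemma unit_val x : x != 0 -> exists u : {unit F}, x = val u.
Proof. by move=> x_neq0; exists (finField_unit x_neq0). Qed.

Lemma unit_val_neq0 (u : {unit F}) : val u != 0.
Proof. by rewrite -unitfE (valP u). Qed.

Lemma ext0 chi : ext chi 0 = 0.
Proof. by rewrite /ext insubF // unitr0. Qed.

Lemma ext_val chi (u : {unit F}) : ext chi (val u) = chi u.
Proof. by rewrite /ext valK. Qed.

Lemma ext_cfun1 x : ext 1 x = (x != 0)%:R.
Proof.
have [->|/unit_val[u ->]] := eqVneq x 0; first by rewrite ext0.
by rewrite ext_val cfun1E inE.
Qed.

Lemma ext_cfunM chi psi x : ext (chi * psi) x = ext chi x * ext psi x.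
Proof.
have [->|/unit_val[u ->]] := eqVneq x 0; first by rewrite !ext0 mul0r.
by rewrite !ext_val cfunE.
Qed.

Lemma ext_cfunX chi n x : x != 0 -> ext (chi ^+ n) x = ext chi x ^+ n.
Proof. by case/unit_val=> u ->; rewrite !ext_val exp_cfunE ?inE. Qed.

Section Linear.
Variable chi : 'CF(UG F).
Hypothesis chi_lin : chi \is a linear_char.

Lemma ext1 : ext chi 1 = 1.
Proof. by rewrite -[1]/(val (1%g : {unit F})) ext_val lin_char1. Qed.

Lemma extM : {morph ext chi : x y / x * y}.
Proof.
move=> x y; have [->|/unit_val[u ->]] := eqVneq x 0; first by rewrite mul0r ext0 mul0r.
have [->|/unit_val[v ->]] := eqVneq y 0; first by rewrite mulr0 ext0 mulr0.
by rewrite -[_ * _ in LHS]/(val (u * v)%g) !ext_val lin_charM ?inE.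
Qed.

Lemma extX n : {morph ext chi : x / x ^+ n}.
Proof. by move=> x; elim: n => [|n IHn]; rewrite ?ext1 // !exprS extM IHn. Qed.

Lemma ext_neq0 x : x != 0 -> ext chi x != 0.
Proof. by case/unit_val=> u ->; rewrite ext_val lin_char_neq0 ?inE. Qed.

Lemma extV : {morph ext chi : x / x^-1}.
Proof.
move=> x; have [->|x_neq0] := eqVneq x 0; first by rewrite invr0 ext0 invr0.
by apply: (mulfI (ext_neq0 x_neq0)); rewrite -extM !divff ?ext1 ?ext_neq0.
Qed.

Lemma ext_cfunV x : ext chi^-1 x = (ext chi x)^-1.
Proof.
have [->|x_neq0] := eqVneq x 0; first by rewrite !ext0 invr0.
apply: (mulfI (ext_neq0 x_neq0)); rewrite -ext_cfunM divff ?ext_neq0 //.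
by rewrite divrr ?lin_char_unitr // ext_cfun1 x_neq0.
Qed.

Lemma ext_prim_root_inj w : N.-primitive_root w -> ext chi w = 1 -> chi = 1.
Proof.
move=> w_prim chi_w; apply/cfun_inP => u _; rewrite cfun1E inE -ext_val.
have [k ->] := prim_rootP w_prim (expf_pred_card (unit_val_neq0 u)).
by rewrite extX chi_w expr1n.
Qed.

Lemma lin_char_expr_pred_card : chi ^+ N = 1.
Proof.
apply/cfun_inP => u _; rewrite cfun1E inE -ext_val ext_cfunX ?unit_val_neq0 //.
by rewrite -extX expf_pred_card ?unit_val_neq0 // ext1.
Qed.

Lemma lin_char_order_dvdn m : m.-primitive_root chi -> (m %| N)%N.
Proof. by move=> chi_prim; rewrite (prim_order_dvd chi_prim) lin_char_expr_pred_card. Qed.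

Lemma sum_ext : \sum_x ext chi x = N%:R *+ (chi == 1).
Proof.
case: eqP => [->|chi_neq1].
  rewrite (bigD1 0) //= ext0 add0r (eq_bigr (fun=> 1)) => [|x x_neq0].
    by rewrite sumr_const; congr (_%:R); rewrite -(cardC1 (0 : F)); apply: eq_card.
  by rewrite ext_cfun1 x_neq0.
have [w w_prim] := finField_prim_root F.
have w_neq0 := prim_root_neq0 w_prim.
apply: (@eq_mul_neq1_eq0 _ (ext chi w)).
  by rewrite mulr_sumr (reindex_inj (mulfI w_neq0)); apply: eq_bigr => x _; rewrite extM.
by apply/eqP => /(ext_prim_root_inj w_prim).
Qed.

End Linear.

Lemma ext_prim_root m w chi : chi \is a linear_char ->
  N.-primitive_root w -> m.-primitive_root chi -> m.-primitive_root (ext chi w).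
Proof.
move=> chi_lin w_prim chi_prim.
have w_neq0 := prim_root_neq0 w_prim.
have chi_w_m : ext chi w ^+ m = 1.
  by rewrite -ext_cfunX // (prim_expr_order chi_prim) ext_cfun1 w_neq0.
have [k chi_w_prim k_dvd] := prim_order_exists (prim_order_gt0 chi_prim) chi_w_m.
suff -> : m = k by [].
apply/eqP; rewrite eqn_dvd k_dvd andbT (prim_order_dvd chi_prim).
apply/eqP/(ext_prim_root_inj _ w_prim); first exact: rpredX.
by rewrite ext_cfunX // prim_expr_order.
Qed.

Lemma sum_irr_ext x : \sum_(i : Iirr (UG F)) ext 'chi_i x = N%:R *+ (x == 1).
Proof.
have [->|/unit_val[u ->]] := eqVneq x 0.
  by rewrite eq_sym oner_eq0 big1 // => i _; rewrite ext0.
have := cfRegE (UG F) u; rewrite cfReg_sum sum_cfunE card_finField_unit.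
rewrite (_ : (u == 1%g) = (val u == 1)) // => <-; apply: eq_bigr => i _.
by rewrite ext_val cfunE lin_char1 ?irr_UG_lin // mul1r.
Qed.

Lemma sum_irr_mul_lin (G : 'CF(UG F) -> algC) lam : lam \is a linear_char ->
  \sum_(i : Iirr (UG F)) G (lam * 'chi_i) = \sum_(i : Iirr (UG F)) G 'chi_i.
Proof.
move=> lam_lin; pose mul_lam i := cfIirr (lam * 'chi_i).
have mul_lamE i : 'chi_(mul_lam i) = lam * 'chi_i.
  by rewrite cfIirrE // mul_lin_irr ?mem_irr.
rewrite [RHS](reindex_inj (h := mul_lam)) => [|i j eq_ij].
  by apply: eq_bigr => i _; rewrite mul_lamE.
by apply/irr_inj/(mulrI (lin_char_unitr lam_lin)); rewrite -!mul_lamE eq_ij.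
Qed.

Lemma ext_sqr_neg1 chi : chi \is a linear_char -> ext chi (-1) ^+ 2 = 1.
Proof. by move=> chi_lin; rewrite -extX // sqrrN expr1n ext1. Qed.

Lemma ext_even_neg1 chi n : chi \is a linear_char -> ~~ odd n -> ext (chi ^+ n) (-1) = 1.
Proof.
move=> chi_lin /even_halfK <-; rewrite -mul2n exprM ext_cfunX ?oppr1_neq0 //.
by rewrite ext_cfunX ?oppr1_neq0 // ext_sqr_neg1 // expr1n.
Qed.

End MultiplicativeCharacters.

(** * Gauss and Jacobi sums *)

Section GaussSums.
Variables (F : finFieldType) (theta : 'CF([set: F])).
Hypotheses (theta_lin : theta \is a linear_char) (theta_neq1 : theta != 1).
Implicit Types (chi psi : 'CF(UG F)) (x y : F).

Lemma addchar0 : theta 0 = 1.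
Proof. exact: lin_char1. Qed.

Lemma addcharD : {morph theta : x y / x + y >-> x * y}.
Proof. by move=> x y; rewrite -[x + y]/(x * y)%g lin_charM ?inE. Qed.

Lemma addchar_neq1 : exists x, theta x != 1.
Proof.
apply/existsP; rewrite -negb_forall; apply: contra theta_neq1 => /forallP theta_eq1.
by apply/eqP/cfun_inP => x _; rewrite cfun1E inE; apply/eqP.
Qed.

Lemma sum_addchar a : \sum_x theta (a * x) = #|F|%:R *+ (a == 0).
Proof.
have [->|a_neq0] := eqVneq a 0.
  by under eq_bigr => x _ do rewrite mul0r addchar0; rewrite sumr_const.
have [y theta_y] := addchar_neq1.
apply: eq_mul_neq1_eq0 theta_y.
rewrite mulr_sumr (reindex_inj (addrI (y / a))); apply: eq_bigr => x _.
by rewrite -addcharD mulrDr mulrC divfK.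
Qed.

Definition gauss chi := \sum_x ext chi x * theta x.

Lemma gauss_scale chi a : chi \is a linear_char -> a != 0 ->
  \sum_x ext chi x * theta (a * x) = ext chi^-1 a * gauss chi.
Proof.
move=> chi_lin a_neq0; rewrite mulr_sumr (reindex_inj (mulfI (invr_neq0 a_neq0))).
by apply: eq_bigr => x _; rewrite mulVKf // extM // extV // ext_cfunV // mulrA.
Qed.

Lemma gauss_scale_neq1 chi a : chi \is a linear_char -> chi != 1 ->
  \sum_x ext chi x * theta (a * x) = ext chi^-1 a * gauss chi.
Proof.
move=> chi_lin chi_neq1; have [->|] := eqVneq a 0; last exact: gauss_scale.
under eq_bigr => x _ do rewrite mul0r addchar0 mulr1.
by rewrite ext0 mul0r sum_ext // (negbTE chi_neq1).
Qed.

Lemma gauss1 : gauss 1 = -1.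
Proof.
have := sum_addchar 1; rewrite oner_eq0 (bigD1 0) //= mulr0 addchar0 => /eqP.
rewrite addrC addr_eq0 => /eqP <-; rewrite /gauss (bigD1 0) //= ext0 mul0r add0r.
by apply: eq_bigr => x x_neq0; rewrite ext_cfun1 x_neq0 !mul1r.
Qed.

Lemma gauss_mulV chi : chi \is a linear_char -> chi != 1 ->
  gauss chi * gauss chi^-1 = ext chi (-1) * #|F|%:R.
Proof.
move=> chi_lin chi_neq1; rewrite [gauss chi^-1]/gauss mulr_sumr.
transitivity (\sum_y \sum_x ext chi x * theta ((1 + x) * y)).
  apply: eq_bigr => y _; rewrite mulrA [X in X * _]mulrC -gauss_scale_neq1 // mulr_suml.
  by apply: eq_bigr => x _; rewrite -mulrA -addcharD; congr (_ * theta _); ring.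
rewrite exchange_big (bigD1 (-1)) //= -mulr_sumr sum_addchar subrr eqxx.
rewrite big1 ?addr0 // => x x_neqN1.
by rewrite -mulr_sumr sum_addchar addrC addr_eq0 (negbTE x_neqN1) mulr0.
Qed.

Lemma gauss_neq0 chi : chi \is a linear_char -> gauss chi != 0.
Proof.
move=> chi_lin; have [->|chi_neq1] := eqVneq chi 1.
  by rewrite gauss1 oppr1_neq0.
apply/eqP => gauss_eq0; have /eqP := gauss_mulV chi_lin chi_neq1.
rewrite gauss_eq0 mul0r eq_sym mulf_eq0 (negbTE (card_finField_neq0 F)) orbF.
by rewrite (negbTE (ext_neq0 chi_lin (oppr1_neq0 F))).
Qed.

Lemma jacobi_gauss chi psi :
    chi \is a linear_char -> psi \is a linear_char -> chi * psi != 1 ->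
  (\sum_x ext chi x * ext psi (1 - x)) * gauss (chi * psi) = gauss chi * gauss psi.
Proof.
move=> chi_lin psi_lin prod_neq1.
transitivity (\sum_x \sum_s ext chi x * ext psi (s - x) * theta s); last first.
  rewrite [in RHS]/gauss [RHS]mulr_suml; apply: eq_bigr => x _.
  rewrite mulr_sumr [RHS](reindex_inj (addIr (- x))) /=.
  by apply: eq_bigr => s _; rewrite -{2}[s](subrK x) addcharD; ring.
rewrite exchange_big /= mulr_sumr; apply: eq_bigr => s _.
have [->|s_neq0] := eqVneq s 0.
  rewrite ext0 mul0r mulr0; under eq_bigr => x _ do
    rewrite sub0r -[- x]mulN1r extM // mulrCA -ext_cfunM addchar0 mulr1.
  by rewrite -mulr_sumr sum_ext ?rpredM // (negbTE prod_neq1) mulr0.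
rewrite mulr_suml [RHS](reindex_inj (mulfI s_neq0)); apply: eq_bigr => x _.
have -> : s - s * x = s * (1 - x) by ring.
by rewrite !extM // ext_cfunM; ring.
Qed.

Lemma gbinom_gauss chi psi :
    chi \is a linear_char -> psi \is a linear_char -> chi * psi^-1 != 1 ->
  gbinom chi psi
    = ext psi (-1) / #|F|%:R * (gauss chi * gauss psi^-1 / gauss (chi * psi^-1)).
Proof.
move=> chi_lin psi_lin quo_neq1; rewrite -jacobi_gauss ?rpredV //.
by rewrite mulfK ?gauss_neq0 ?rpred_div.
Qed.

Lemma prod_gauss_symmetric r n (f : nat -> 'CF(UG F)) : n = (2 * r)%N ->
    (forall i, (i < r)%N ->
       [/\ f i \is a linear_char, f i != 1 & f i * f (n - i.+1)%N = 1]) ->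
  \prod_(i < n) gauss (f i) = \prod_(i < r) ext (f i) (-1) * #|F|%:R ^+ r.
Proof.
move=> -> f_symm; rewrite mul2n -addnn big_split_ord /=.
rewrite [X in _ * X](reindex_inj rev_ord_inj) -big_split /=.
rewrite -[X in _ ^+ X]card_ord -prodr_const -big_split; apply: eq_bigr => i _ /=.
have [f_lin f_neq1] := f_symm i (ltn_ord i).
by rewrite mul2n -addnn -addnBA // => /mulr1_eq <-; rewrite gauss_mulV.
Qed.

End GaussSums.

Lemma exists_addchar (F : finFieldType) :
  exists2 theta : 'CF([set: F]), theta \is a linear_char & theta != 1.
Proof.
have abF : abelian [set: F] by apply: FinRing.zmod_abelian.
have /card_gt1P[i [j [_ _ neq_ij]]] : (1 < #|Iirr [set: F]|)%N.
  by rewrite card_Iirr_abelian // cardsT finNzRing_gt1.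
have lin_irr k : 'chi[[set: F]]_k \is a linear_char by apply/char_abelianP.
have [i0|i_neq0] := eqVneq i 0; last first.
  by exists 'chi_i; rewrite // irr_eq1.
by exists 'chi_j; rewrite // irr_eq1 -i0 eq_sym.
Qed.

(** * The Hasse-Davenport product formula *)

Lemma splits_prim_root (K : fieldType) n (rs : seq K) : (0 < n)%N -> n%:R != 0 :> K ->
    'X^n - 1 = \prod_(r <- rs) ('X - r%:P) ->
  exists z : K, n.-primitive_root z.
Proof.
move=> n_gt0 n_neq0 rsE.
have size_rs : size rs = n.
  by apply: succn_inj; rewrite -(size_prod_XsubC rs id) -rsE size_XnsubC.
have rs_roots : all n.-unity_root rs.
  by apply/allP => x; rewrite -root_prod_XsubC -rsE.
have uniq_rs : uniq rs.
  by rewrite -separable_prod_XsubC -rsE separable_Xn_sub_1.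
have /hasP[z _ z_prim] := has_prim_root n_gt0 rs_roots uniq_rs (eq_leq (esym size_rs)).
by exists z.
Qed.

Lemma sum_exp_prim_root (R : idomainType) m (w : R) a : m.-primitive_root w ->
  \sum_(i < m) (w ^+ a) ^+ i = m%:R *+ (m %| a)%N.
Proof.
move=> w_prim; rewrite (prim_order_dvd w_prim); case: eqP => [->|/eqP wa_neq1].
  by under eq_bigr => i _ do rewrite expr1n; rewrite sumr_const card_ord.
have := subrX1 (w ^+ a) m; rewrite exprAC (prim_expr_order w_prim) expr1n subrr.
by move=> /esym/eqP; rewrite mulf_eq0 subr_eq0 (negbTE wa_neq1) => /eqP.
Qed.

Lemma card_exp_eq_prim_root (K : finFieldType) n m (z : K) a :
    n.-primitive_root z -> (m %| n)%N ->
  #|[pred y : K | (y ^+ n == 1) && (y ^+ m == z ^+ a)]| = (m * (m %| a))%N.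
Proof.
move=> z_prim m_dvd_n; have z_n := prim_expr_order z_prim.
have [/dvdnP[c ->]|m_ndvd_a] := boolP (m %| a)%N; last first.
  rewrite muln0; apply: eq_card0 => y; rewrite inE; apply/andP => -[/eqP y_n].
  have [b ->] := prim_rootP z_prim y_n.
  rewrite -exprM (eq_prim_root_expr z_prim) => /eqP/(congr1 (modn^~ m)).
  rewrite !modn_dvdm // modnMl => /esym/eqP.
  by rewrite -/(dvdn m a) (negbTE m_ndvd_a).
rewrite muln1; have u_prim := dvdn_prim_root z_prim m_dvd_n.
set u := z ^+ _ in u_prim.
have zc_neq0 : z ^+ c != 0 by rewrite expf_neq0 // (prim_root_neq0 z_prim).
have inj_zu : injective (fun i : 'I_m => z ^+ c * u ^+ i).
  move=> i k /(mulfI zc_neq0)/eqP; rewrite (eq_prim_root_expr u_prim) !modn_small //.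
  by move/eqP/val_inj.
rewrite -[RHS]card_ord -(card_codom inj_zu); apply: eq_card => y; rewrite inE.
apply/andP/codomP => [[_ /eqP y_m]|[i ->]].
  have yz_m : (y / z ^+ c) ^+ m = 1.
    by rewrite expr_div_n y_m exprM divff // expf_neq0.
  by have [i iE] := prim_rootP u_prim yz_m; exists i; rewrite -iE mulrC divfK.
split; rewrite exprMn [u ^+ i ^+ _]exprAC.
  by rewrite [z ^+ c ^+ n]exprAC [u ^+ n]exprAC z_n !expr1n mulr1.
by rewrite (prim_expr_order u_prim) expr1n mulr1 exprM.
Qed.

Section HasseDavenport.
Variables (F : finFieldType) (theta : 'CF([set: F])).
Hypotheses (theta_lin : theta \is a linear_char) (theta_neq1 : theta != 1).
Variables (K : finFieldType) (iota : {rmorphism F -> K}) (retr : {additive K -> F}).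
Hypothesis iotaK : cancel iota retr.
Variable deg_bound : nat.
Hypothesis splits : splits_monic iota deg_bound.
Implicit Types (chi rho : 'CF(UG F)) (f g : {poly F}) (x y : K).

Local Notation q := #|F|.
Local Notation gauss := (gauss theta).
Local Notation frobenius := (@frobenius F K).
Local Notation frobenius_sum := (frobenius_sum retr).
Local Notation char_poly_ext := (char_poly_ext retr).
Local Notation "f ^iota" := (map_poly iota f) (at level 2, format "f ^iota").

Definition root_power_sum m f : K := \sum_(y : K) y ^+ m *+ mup y f^iota.
Definition root_prod f : F := (-1) ^+ (size f).-1 * f`_0.
Definition root_weight chi m f : algC :=
  ext chi (root_prod f) * theta (retr (root_power_sum m f)).

Lemma root_power_sumE m f rs : f^iota = \prod_(r <- rs) ('X - r%:P) ->
  root_power_sum m f = power_sum rs m.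
Proof.
move=> fE; rewrite /root_power_sum fE /power_sum.
under [LHS]eq_bigr => y _ do rewrite mu_prod_XsubC.
elim: rs {fE} => [|r rs IHrs] /=; first by rewrite big_nil big1.
rewrite big_cons -IHrs; under eq_bigr => y _ do rewrite mulrnDr.
rewrite big_split (bigD1 r) //= eqxx big1 ?addr0 // => y /negbTE.
by rewrite eq_sym => ->.
Qed.

Lemma root_power_sumM m : {in monic &, {morph root_power_sum m : f g / f * g >-> f + g}}.
Proof.
move=> f g monic_f monic_g; rewrite /root_power_sum rmorphM /= -big_split.
by apply: eq_bigr => y _ /=; rewrite mupM ?mulrnDr // map_poly_eq0 monic_neq0.
Qed.

Lemma root_prodM : {in monic &, {morph root_prod : f g / f * g}}.
Proof.
move=> f g monic_f monic_g.
have [f_gt0 g_gt0] : (0 < size f)%N /\ (0 < size g)%N.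
  by rewrite !size_poly_gt0 !monic_neq0.
rewrite /root_prod size_monicM ?monic_neq0 // coef0M.
have -> : (size f + size g).-1.-1 = ((size f).-1 + (size g).-1)%N by lia.
by rewrite exprD; ring.
Qed.

Lemma root_weightM chi m : chi \is a linear_char ->
  monic_multiplicative (root_weight chi m).
Proof.
move=> chi_lin f g monic_f monic_g.
rewrite /root_weight root_prodM // root_power_sumM // raddfD extM // addcharD //.
by ring.
Qed.

Definition ext_norm j y : F := retr (\prod_(z <- traject frobenius y j) z).
Definition ext_trace j y : F := retr (\sum_(z <- traject frobenius y j) z).

Lemma iota_root_prod j y : iter j frobenius y = y ->
  iota (root_prod (char_poly_ext j y)) = \prod_(z <- traject frobenius y j) z.
Proof.
move=> fix_y; rewrite /root_prod (size_char_poly_ext iotaK) //=.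
rewrite rmorphM rmorphXn rmorphN1 -(coef_map iota) (map_char_poly_ext iotaK) // /conj_prod.
by rewrite coef0_prod_XsubC size_traject mulrA -exprMn mulrNN mulr1 expr1n mul1r.
Qed.

Lemma iota_ext_norm j y : iter j frobenius y = y ->
  iota (ext_norm j y) = \prod_(z <- traject frobenius y j) z.
Proof. by move=> fix_y; rewrite /ext_norm -iota_root_prod // iotaK. Qed.

Lemma root_weight_char_poly_ext chi m j y : iter j frobenius y = y ->
  root_weight chi m (char_poly_ext j y)
    = ext chi (ext_norm j y) * theta (ext_trace j (y ^+ m)).
Proof.
move=> fix_y; rewrite /root_weight /ext_norm -iota_root_prod // iotaK.
rewrite (root_power_sumE _ (map_char_poly_ext iotaK fix_y)) /power_sum /ext_trace.
rewrite !big_traject; congr (_ * theta (retr _)); apply: eq_bigr => i _.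
by rewrite !iter_frobenius exprAC.
Qed.

Lemma sum_monic_root_weight0 chi m : chi \is a linear_char ->
  sum_monic (root_weight chi m) 0 = 1.
Proof.
move=> chi_lin; rewrite /sum_monic (eq_bigr (fun=> 1)) => [|c _].
  by rewrite sumr_const card_mx.
have -> : monic_rVpoly c = 1.
  rewrite /monic_rVpoly expr0 -[RHS]addr0; congr (_ + _).
  by apply/eqP; rewrite -size_poly_leq0 size_rVpoly.
rewrite /root_weight /root_prod size_poly1 coef1 mulr1 ext1 // mul1r.
rewrite (@root_power_sumE _ _ [::]) ?rmorph1 ?big_nil //.
by rewrite /power_sum big_nil raddf0 addchar0.
Qed.

Lemma signed_esym_monic_rVpoly n (c : 'rV[F]_n) rs : size rs = n ->
    (monic_rVpoly c)^iota = \prod_(r <- rs) ('X - r%:P) ->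
  forall i : 'I_n, signed_esym rs (n - i) = iota (c 0 i).
Proof.
move=> size_rs rsE i; rewrite -coef_prod_XsubC ?size_rs ?leq_subr // -rsE.
by rewrite subKn ?coef_map ?coef_monic_rVpoly // ltnW.
Qed.

Lemma root_prod_monic_rVpoly n (c : 'rV[F]_n.+1) :
  root_prod (monic_rVpoly c) = (-1) ^+ n.+1 * c 0 0.
Proof.
by rewrite /root_prod size_monic_rVpoly -[0%N]/(val (0 : 'I_n.+1)) coef_monic_rVpoly.
Qed.

Lemma root_power_sum1 n (c : 'rV[F]_n.+1) : (n < deg_bound)%N ->
  root_power_sum 1 (monic_rVpoly c) = - iota (c 0 ord_max).
Proof.
move=> lt_n; have [rs size_rs rsE] := monic_rVpoly_splits splits c lt_n.
rewrite (root_power_sumE _ rsE) power_sum_newton big_ord0 subr0 mul1r.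
by rewrite -(signed_esym_monic_rVpoly size_rs rsE ord_max) /= subSnn.
Qed.

Section DegreeOne.
Variable chi : 'CF(UG F).
Hypothesis chi_lin : chi \is a linear_char.

Lemma sum_monic_root_weight1 : (0 < deg_bound)%N ->
  sum_monic (root_weight chi 1) 1 = gauss chi.
Proof.
move=> bound_gt0; rewrite /sum_monic (reindex (fun x : F => const_mx (- x) : 'rV[F]_1)).
  apply: eq_bigr => x _; rewrite /root_weight root_prod_monic_rVpoly root_power_sum1 //.
  by rewrite !mxE expr1 mulN1r rmorphN !opprK iotaK.
exists (fun c : 'rV[F]_1 => - c 0 0) => [x _|c _]; first by rewrite mxE opprK.
by apply/rowP => i; rewrite mxE opprK ord1.
Qed.

(* Translating the coefficient next to the leading one only changes the trace. *)
Lemma sum_monic_root_weight_gt1 n : (n.+1 < deg_bound)%N ->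
  sum_monic (root_weight chi 1) n.+2 = 0.
Proof.
move=> lt_n; have [y theta_y] := addchar_neq1 theta_neq1.
pose shift : 'rV[F]_n.+2 := - y *: delta_mx 0 ord_max.
set S := sum_monic _ _; have : S = theta y * S.
  rewrite {1}/S /sum_monic (reindex_inj (addIr shift)) mulr_sumr; apply: eq_bigr => c _.
  rewrite /root_weight !root_prod_monic_rVpoly !root_power_sum1 // -!rmorphN !iotaK.
  by rewrite !mxE !eqxx mulr0 mulr1 addr0 opprB addcharD //; ring.
by move/eq_mul_neq1_eq0; apply.
Qed.

Lemma hasse_davenport_lift j : (j < deg_bound)%N ->
  frobenius_sum (root_weight chi 1) j.+1 = - (- gauss chi) ^+ j.+1.
Proof.
have recursion := sum_monic_recursion iotaK splits (root_weightM 1 chi_lin).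
elim: j => [|j IHj] lt_j; have := recursion _ lt_j.
  rewrite big_ord1 sum_monic_root_weight0 // sum_monic_root_weight1 //.
  by rewrite mulr1 mul1r opprK => <-.
rewrite sum_monic_root_weight_gt1 // mulr0 !big_ord_recr /= subnn subSnn.
rewrite sum_monic_root_weight0 // sum_monic_root_weight1 ?(leq_ltn_trans _ lt_j) //.
rewrite big1 ?add0r => [|i _].
  rewrite IHj 1?ltnW // mulr1 => /esym/eqP; rewrite addrC addr_eq0 => /eqP ->.
  by rewrite [in RHS]exprS; ring.
have -> : (j.+1 - i = (j - i.+1).+2)%N by have := ltn_ord i; lia.
by rewrite sum_monic_root_weight_gt1 ?mulr0 //; lia.
Qed.

End DegreeOne.

Lemma frobenius_iter_expr j n y : iter j frobenius y = y ->
  iter j frobenius (y ^+ n) = y ^+ n.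
Proof. by rewrite !iter_frobenius exprAC => ->. Qed.

Lemma ext_norm_expr j n y : iter j frobenius y = y ->
  ext_norm j (y ^+ n) = ext_norm j y ^+ n.
Proof.
move=> fix_y; apply: (fmorph_inj iota).
rewrite rmorphXn !iota_ext_norm ?frobenius_iter_expr // !big_traject -prodrXl.
by apply: eq_bigr => i _; rewrite !iter_frobenius exprAC.
Qed.

Lemma ext_norm0 j : ext_norm j.+1 0 = 0.
Proof. by rewrite /ext_norm big_cons mul0r raddf0. Qed.

Section FieldExtension.
Variable j : nat.
Hypothesis le_bound : (q ^ j.+1 <= deg_bound)%N.
Local Notation Q := (q ^ j.+1).-1.

Lemma iter_frobenius_eq y : y != 0 -> (iter j.+1 frobenius y == y) = (y ^+ Q == 1).
Proof.
move=> y_neq0; have q_gt0 : (0 < q)%N := ltnW (finNzRing_gt1 F).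
rewrite iter_frobenius -[(q ^ _)%N]prednK ?expn_gt0 ?q_gt0 //.
by rewrite exprS -[X in _ == X]mulr1 (inj_eq (mulfI y_neq0)).
Qed.

Lemma exists_prim_root_ext : exists z : K, Q.-primitive_root z.
Proof.
have Q_gt0 : (0 < Q)%N.
  by rewrite -subn1 subn_gt0 -(exp1n j.+1) ltn_exp2r // finNzRing_gt1.
have Q_succ : Q.+1 = (q ^ j.+1)%N by rewrite prednK // expn_gt0 card_finField_succ.
have [|rs rsE] := @splits ('X^Q - 1) (monicXnsubC _ Q_gt0).
  by rewrite size_XnsubC // Q_succ leqW.
apply: (@splits_prim_root _ _ rs) => //; last first.
  by rewrite -rsE rmorphB /= map_polyXn rmorph1.
have q_eq0 : q%:R = 0 :> K.
  rewrite -(rmorph_nat iota); apply/eqP; rewrite fmorph_eq0 -cardsT.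
  by rewrite -FinRing.zmodXgE expg_cardG ?inE.
have : Q.+1%:R = 0 :> K by rewrite Q_succ natrX q_eq0 exprS mul0r.
by rewrite -natr1 => /eqP; rewrite addr_eq0 => /eqP ->; apply: oppr1_neq0.
Qed.

Lemma prim_root_ext_fixed z : Q.-primitive_root z -> iter j.+1 frobenius z = z.
Proof.
move=> z_prim; apply/eqP; rewrite iter_frobenius_eq ?(prim_expr_order z_prim) //.
exact: prim_root_neq0 z_prim.
Qed.

Lemma ext_norm_prim_root z : Q.-primitive_root z -> q.-1.-primitive_root (ext_norm j.+1 z).
Proof.
move=> z_prim; have fix_z := prim_root_ext_fixed z_prim.
rewrite -(fmorph_primitive_root iota) iota_ext_norm // big_traject.
under eq_bigr => i _ do rewrite iter_frobenius.
have Q_fact : Q = (q.-1 * \sum_(i < j.+1) q ^ i)%N by rewrite predn_exp.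
have := exp_prim_root z_prim (\sum_(i < j.+1) q ^ i)%N.
rewrite expr_sum {1 2}Q_fact gcdnMl mulnK //.
by move: (prim_order_gt0 z_prim); rewrite Q_fact muln_gt0 => /andP[].
Qed.

Lemma sum_ext_norm rho m x : rho \is a linear_char -> m.-primitive_root rho ->
    iter j.+1 frobenius x = x -> x != 0 ->
  \sum_(i < m) ext (rho ^+ i) (ext_norm j.+1 x)
    = #|[pred y : K | (iter j.+1 frobenius y == y) && (y ^+ m == x)]|%:R.
Proof.
move=> rho_lin rho_prim fix_x x_neq0; have [z z_prim] := exists_prim_root_ext.
have m_dvd_q := lin_char_order_dvdn rho_lin rho_prim.
have m_gt0 := prim_order_gt0 rho_prim.
have norm_z_prim := ext_norm_prim_root z_prim.
have fix_z := prim_root_ext_fixed z_prim.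
have /eqP x_Q : x ^+ Q == 1 by rewrite -iter_frobenius_eq // fix_x.
have [a xE] := prim_rootP z_prim x_Q.
have -> : #|[pred y : K | (iter j.+1 frobenius y == y) && (y ^+ m == x)]|
        = #|[pred y : K | (y ^+ Q == 1) && (y ^+ m == z ^+ a)]|.
  apply: eq_card => y; rewrite !inE xE.
  have [y_m|_] := eqVneq (y ^+ m) (z ^+ a); last by rewrite !andbF.
  rewrite !andbT iter_frobenius_eq //; apply: contraNneq x_neq0 => y0.
  by rewrite xE -y_m y0 expr0n gtn_eqF.
rewrite (card_exp_eq_prim_root _ z_prim) ?predn_exp ?dvdn_mulr // natrM mulr_natr.
rewrite -(sum_exp_prim_root _ (ext_prim_root rho_lin norm_z_prim rho_prim)).
apply: eq_bigr => i _; rewrite xE ext_norm_expr // -extX // ext_cfunX //.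
by rewrite expf_neq0 // (prim_root_neq0 norm_z_prim).
Qed.

Lemma frobenius_sum_twist rho chi m :
    rho \is a linear_char -> m.-primitive_root rho -> chi \is a linear_char ->
  frobenius_sum (root_weight (chi ^+ m) m) j.+1
    = \sum_(i < m) frobenius_sum (root_weight (rho ^+ i * chi) 1) j.+1.
Proof.
move=> rho_lin rho_prim chi_lin; have m_gt0 := prim_order_gt0 rho_prim.
pose G x := ext chi (ext_norm j.+1 x) * theta (ext_trace j.+1 x).
have -> : frobenius_sum (root_weight (chi ^+ m) m) j.+1
    = \sum_(y : K | iter j.+1 frobenius y == y) G (y ^+ m).
  apply: eq_bigr => y /eqP fix_y; rewrite root_weight_char_poly_ext // /G ext_norm_expr //.
  rewrite extX //; congr (_ * _); have [->|] := eqVneq (ext_norm j.+1 y) 0.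
    by rewrite !ext0 expr0n gtn_eqF.
  exact: ext_cfunX.
rewrite (partition_big (fun y => y ^+ m) (fun x => iter j.+1 frobenius x == x));
  last by move=> y /eqP fix_y; apply/eqP/frobenius_iter_expr.
rewrite exchange_big; apply: eq_bigr => x /eqP fix_x /=.
transitivity (\sum_(i < m) ext (rho ^+ i) (ext_norm j.+1 x) * G x); last first.
  apply: eq_bigr => i _; rewrite root_weight_char_poly_ext // expr1 ext_cfunM.
  by rewrite -mulrA.
rewrite (eq_bigr (fun=> G x)) => [|y /andP[_ /eqP -> //]].
rewrite sumr_const -mulr_suml; have [->|x_neq0] := eqVneq x 0.
  by rewrite /G ext_norm0 ext0 mul0r mul0rn mulr0.
by rewrite sum_ext_norm // mulr_natl.
Qed.

End FieldExtension.

Lemma sum_monic_root_weight_prod rho chi m :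
    rho \is a linear_char -> m.-primitive_root rho -> chi \is a linear_char ->
    (q ^ m <= deg_bound)%N ->
  sum_monic (root_weight (chi ^+ m) m) m = \prod_(i < m) gauss (rho ^+ i * chi).
Proof.
move=> rho_lin rho_prim chi_lin le_bound; have q_gt1 := finNzRing_gt1 F.
have lt_bound n : (n < m)%N -> (q ^ n.+1 <= deg_bound)%N.
  by move=> lt_nm; rewrite (leq_trans _ le_bound) // leq_pexp2l // ltnW.
pose rs := [seq - gauss (rho ^+ (i : 'I_m) * chi) | i <- enum 'I_m].
have size_rs : size rs = m by rewrite size_map size_enum_ord.
have lin_chi_m : chi ^+ m \is a linear_char by rewrite rpredX.
rewrite (newton_recursion_unique (rs := rs) (m := m)) ?sum_monic_root_weight0 //.
  rewrite -coef_prod_XsubC ?size_rs // subnn coef0_prod_XsubC size_rs big_map big_enum.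
  rewrite -[m in (-1) ^+ m]card_ord -prodrN.
  by apply: eq_bigr => i _; rewrite opprK.
move=> n lt_nm; have lt_n_bound : (n < deg_bound)%N.
  by rewrite (leq_trans _ (lt_bound _ lt_nm)) // ltnW // ltn_expl.
rewrite (sum_monic_recursion iotaK splits) //; last exact: root_weightM.
rewrite -sumrN; apply: eq_bigr => j _; rewrite -mulNr; congr (_ * _).
have lt_jm : (j < m)%N by apply: leq_trans lt_nm.
rewrite (frobenius_sum_twist (lt_bound _ lt_jm) rho_lin rho_prim) //.
rewrite /power_sum big_map big_enum -sumrN; apply: eq_bigr => i _.
rewrite hasse_davenport_lift ?rpredM ?rpredX //.
by rewrite (leq_ltn_trans _ lt_n_bound) // -ltnS.
Qed.

Lemma root_power_sum_top m (c : 'rV[F]_m.+1) a : (m < deg_bound)%N ->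
  root_power_sum m.+1 (monic_rVpoly (c + a *: delta_mx 0 0))
    = root_power_sum m.+1 (monic_rVpoly c) - iota (m.+1%:R * a).
Proof.
move=> lt_m.
have [rs size_rs rsE] := monic_rVpoly_splits splits c lt_m.
have [ss size_ss ssE] := monic_rVpoly_splits splits (c + a *: delta_mx 0 0) lt_m.
have esym_rs := signed_esym_monic_rVpoly size_rs rsE.
have esym_ss := signed_esym_monic_rVpoly size_ss ssE.
rewrite (root_power_sumE _ rsE) (root_power_sumE _ ssE).
rewrite (@power_sum_top _ ss rs) => [|[|n] le_nm]; last 2 first.
- by rewrite !signed_esym0.
- have lt_i : (m - n < m.+1)%N by rewrite ltnS leq_subr.
  have := esym_rs (Ordinal lt_i); have := esym_ss (Ordinal lt_i); rewrite /=.
  have -> : (m.+1 - (m - n))%N = n.+1 by lia.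
  move=> -> ->; rewrite !mxE (_ : Ordinal lt_i == 0 = false) ?andbF ?mulr0 ?addr0 //.
  by apply/negbTE; rewrite -val_eqE /= -lt0n subn_gt0.
have := esym_rs 0; have := esym_ss 0; rewrite subn0 => -> ->.
by rewrite !mxE !eqxx mulr1 rmorphD rmorphM rmorph_nat; ring.
Qed.

Lemma sum_monic_root_weight_top m chi : chi \is a linear_char -> (m < deg_bound)%N ->
    m.+1%:R != 0 :> F ->
  sum_monic (root_weight chi m.+1) m.+1 =
    (\sum_(c : 'rV[F]_m.+1 | c 0 0 == 0)
        theta (retr (root_power_sum m.+1 (monic_rVpoly c))))
    * (ext chi ((-1) ^+ m.+1) * ext chi^-1 (- m.+1%:R) * gauss chi).
Proof.
move=> chi_lin lt_m m_neq0; rewrite -mulrA -gauss_scale ?oppr_eq0 // mulr_sumr.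
rewrite /sum_monic (partition_big (fun c : 'rV_m.+1 => c 0 0) xpredT) //= mulr_sumr.
apply: eq_bigr => a _; rewrite mulr_suml (reindex_inj (addIr (a *: delta_mx 0 0))).
apply: eq_big => [c|c]; rewrite !mxE !eqxx mulr1 -subr_eq0 addrK // => /eqP c0.
rewrite /root_weight root_prod_monic_rVpoly root_power_sum_top // raddfB iotaK /=.
by rewrite !mxE !eqxx mulr1 c0 add0r extM // -mulNr addcharD //; ring.
Qed.

Lemma hasse_davenport_of_splits rho chi m :
    rho \is a linear_char -> m.-primitive_root rho -> chi \is a linear_char ->
    (q ^ m <= deg_bound)%N -> m%:R != 0 :> F ->
  \prod_(i < m) gauss (rho ^+ i * chi)
    = (ext (chi ^+ m) m%:R)^-1 * gauss (chi ^+ m) * \prod_(i < m.-1) gauss (rho ^+ i.+1).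
Proof.
case: m => // m rho_lin rho_prim chi_lin le_bound m_neq0.
have lt_m : (m < deg_bound)%N.
  by rewrite (leq_trans _ le_bound) // ltnW // ltn_expl // finNzRing_gt1.
have neg1_neq0 := oppr1_neq0 F.
pose C := \sum_(c : 'rV[F]_m.+1 | c 0 0 == 0)
  theta (retr (root_power_sum m.+1 (monic_rVpoly c))).
have prodE psi : psi \is a linear_char -> \prod_(i < m.+1) gauss (rho ^+ i * psi)
    = C * ((ext (psi ^+ m.+1) m.+1%:R)^-1 * gauss (psi ^+ m.+1)).
  move=> psi_lin; have psiX_lin : psi ^+ m.+1 \is a linear_char by rewrite rpredX.
  rewrite -(sum_monic_root_weight_prod rho_lin) // sum_monic_root_weight_top //.
  congr (_ * (_ * _)); rewrite ext_cfunV // -[- m.+1%:R]mulN1r extM // extX //.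
  rewrite invfM mulrA exprSr mulfK ?ext_neq0 // -ext_cfunX // -exprM.
  by rewrite ext_even_neg1 ?mul1r // oddM /= andNb.
have <- : C = \prod_(i < m) gauss (rho ^+ i.+1).
  apply: oppr_inj; rewrite -[RHS]mulN1r -(gauss1 theta_lin theta_neq1).
  have := prodE 1 (rpred1 _); rewrite expr1n ext_cfun1 m_neq0 invr1 mul1r gauss1 //.
  rewrite mulrN1 => <-; rewrite big_ord_recl mulr1 gauss1 //; congr (_ * _).
  by apply: eq_bigr => i _; rewrite mulr1.
by rewrite prodE // mulrC.
Qed.

End HasseDavenport.

Lemma exists_splitting_field (F : finFieldType) n :
  exists (K : finFieldType) (iota : {rmorphism F -> K}) (retr : {additive K -> F}),
    cancel iota retr /\ splits_monic iota n.
Proof.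
pose p := \prod_(c : 'rV[F]_n) monic_rVpoly c.
have p_neq0 : p != 0.
  by apply/prodf_neq0 => c _; rewrite monic_neq0 ?monic_rVpoly_monic.
have [L [rs rsE _]] := FinSplittingFieldFor p_neq0.
pose one_basis : 1.-tuple (finvect_type L) := [tuple 1].
have free_basis : free one_basis by rewrite seq1_free oner_neq0.
exists (finvect_type L), (GRing.in_alg (finvect_type L)), (coord one_basis 0).
split=> [x|f monic_f size_f].
  by rewrite /= linearZ /= (coord_free 0 0 free_basis) mulr1.
pose g := f * 'X^(n.+1 - size f).
have monic_g : g \is monic by rewrite monicMl // monicXn.
have size_g : size g = n.+1.
  by rewrite size_monicM ?monic_neq0 ?monicXn // size_polyXn addnS /= subnKC.
have f_dvd_p : f %| p.
  apply: (@dvdp_trans _ g); first by rewrite dvdp_mulr.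
  rewrite -(monic_rVpolyK monic_g size_g) /p (bigD1 (poly_rV (g - 'X^n))) //=.
  by rewrite dvdp_mulr.
have map_dvd : map_poly (GRing.in_alg L) f %| \prod_(r <- rs) ('X - r%:P).
  by rewrite -(eqp_dvdr _ rsE) dvdp_map.
have [m mE] := dvdp_prod_XsubC map_dvd.
exists (mask m rs); apply/eqP; rewrite -eqp_monic ?map_monic //.
exact: monic_prod_XsubC.
Qed.

Theorem hasse_davenport (F : finFieldType) (theta : 'CF([set: F])) (rho chi : 'CF(UG F)) m :
    theta \is a linear_char -> theta != 1 ->
    rho \is a linear_char -> m.-primitive_root rho -> chi \is a linear_char ->
  \prod_(i < m) gauss theta (rho ^+ i * chi)
    = (ext (chi ^+ m) m%:R)^-1 * gauss theta (chi ^+ m)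
      * \prod_(i < m.-1) gauss theta (rho ^+ i.+1).
Proof.
move=> theta_lin theta_neq1 rho_lin rho_prim chi_lin.
have m_neq0 : m%:R != 0 :> F.
  exact/dvdn_pred_card_natf_neq0/(lin_char_order_dvdn rho_lin).
have [K [iota [retr [iotaK splits]]]] := exists_splitting_field F (#|F| ^ m).
exact: (hasse_davenport_of_splits theta_lin theta_neq1 iotaK splits).
Qed.

(** * The character sum of a trinomial *)

Section TrinomialSum.
Variables (F : finFieldType) (theta : 'CF([set: F])).
Hypothesis theta_lin : theta \is a linear_char.
Implicit Types (chi lam : 'CF(UG F)).

Local Notation gauss := (gauss theta).

Lemma gauss_sum_unit chi : gauss chi = \sum_(x | x != 0) ext chi x * theta x.
Proof. by rewrite /gauss (bigD1 0) //= ext0 mul0r add0r. Qed.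

Definition gauss_triple chi n m lam :=
  gauss (chi * lam ^- n) * gauss (lam ^+ m) * gauss lam^-1.

Lemma gauss_tripleE chi lam t n m : chi \is a linear_char -> lam \is a linear_char ->
    t != 0 ->
  ext lam t * gauss_triple chi n m lam
    = \sum_(u | u != 0) \sum_(v | v != 0) \sum_(w | w != 0)
        ext chi u * theta (u + v + w) * ext lam (t * v ^+ m / u ^+ n / w).
Proof.
move=> chi_lin lam_lin t_neq0; rewrite /gauss_triple !gauss_sum_unit big_distrlr /=.
rewrite mulr_suml mulr_sumr; apply: eq_bigr => u u_neq0.
rewrite mulr_suml mulr_sumr; apply: eq_bigr => v v_neq0.
rewrite !mulr_sumr; apply: eq_bigr => w w_neq0.
rewrite !addcharD // !extM // !extV // !extX // ext_cfunM !ext_cfunV ?rpredX //.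
by rewrite !ext_cfunX //; ring.
Qed.

(* Orthogonality of the characters leaves only the terms with w = t v^m / u^n. *)
Lemma sum_gauss_triple chi t n m : chi \is a linear_char -> t != 0 ->
  \sum_(i : Iirr (UG F)) ext 'chi_i t * gauss_triple chi n m 'chi_i
    = #|F|.-1%:R * \sum_(u | u != 0) \sum_(v | v != 0)
        ext chi u * theta (u + v + t * v ^+ m / u ^+ n).
Proof.
move=> chi_lin t_neq0; under eq_bigr => i _ do rewrite gauss_tripleE ?irr_UG_lin //.
rewrite exchange_big mulr_sumr; apply: eq_bigr => u u_neq0 /=.
rewrite exchange_big mulr_sumr; apply: eq_bigr => v v_neq0 /=.
rewrite exchange_big; under eq_bigr => w _ do rewrite -mulr_sumr sum_irr_ext.
set w0 := t * _ / _.
have w0_neq0 : w0 != 0 by rewrite !mulf_neq0 ?invr_neq0 ?expf_neq0.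
rewrite (bigD1 w0) //= divff // eqxx mulrC big1 ?addr0 // => w /andP[w_neq0 w_neq].
by rewrite -(inj_eq (mulIf w_neq0)) divfK // mul1r eq_sym (negbTE w_neq) mulr0.
Qed.

Lemma trinomial_sum_gauss chi n (a b : F) : chi \is a linear_char -> chi != 1 ->
    a != 0 -> b != 0 ->
  #|F|.-1%:R * (gauss chi^-1 * \sum_(x | x != 0) ext chi (x ^+ n.+1 + a * x + b))
    = ext chi b * \sum_(i : Iirr (UG F))
        ext 'chi_i (b ^+ n / a ^+ n.+1) * gauss_triple chi^-1 n n.+1 'chi_i.
Proof.
move=> chi_lin chi_neq1 a_neq0 b_neq0.
have chiV_lin : chi^-1 \is a linear_char by rewrite rpredV.
rewrite sum_gauss_triple ?mulf_neq0 ?invr_neq0 ?expf_neq0 // [RHS]mulrCA; congr (_ * _).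
transitivity (\sum_(z | z != 0) \sum_(x | x != 0)
    ext chi^-1 z * theta ((x ^+ n.+1 + a * x + b) * z)).
  rewrite exchange_big mulr_sumr; apply: eq_bigr => x _ /=.
  rewrite mulrC -[chi in ext chi _]invrK -gauss_scale_neq1 ?invr_eq1 //.
  by rewrite (bigD1 0) //= ext0 mul0r add0r.
rewrite mulr_sumr [RHS](reindex_inj (mulfI b_neq0)) /=.
apply: eq_big => [z|z z_neq0]; first by rewrite mulf_eq0 (negbTE b_neq0).
have az_neq0 : a * z != 0 by rewrite mulf_neq0.
rewrite mulr_sumr [RHS](reindex_inj (mulfI az_neq0)) /=.
apply: eq_big => [x|x x_neq0]; first by rewrite mulf_eq0 (negbTE az_neq0).
rewrite extM // !ext_cfunV // !mulrA divff ?ext_neq0 // mul1r; congr (_ * theta _).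
rewrite !exprMn !exprS; field.
by rewrite !expf_neq0.
Qed.

End TrinomialSum.

Section QuadraticCharacter.
Variables (F : finFieldType) (chi : 'CF(UG F)).
Hypotheses (chi_lin : chi \is a linear_char) (chi_prim : 2.-primitive_root chi).

Lemma qchar_ext x : qchar x = ext chi x.
Proof.
rewrite /qchar; have [->|x_neq0] := eqVneq x 0; first by rewrite ext0.
have ext_sqr y : y != 0 -> ext chi (y ^+ 2) = 1.
  move=> y_neq0; rewrite extX // -ext_cfunX // (prim_expr_order chi_prim).
  by rewrite ext_cfun1 y_neq0.
have [w w_prim] := finField_prim_root F.
have chi_w : ext chi w = -1.
  have chi_w_prim := ext_prim_root chi_lin w_prim chi_prim.
  have /eqP := prim_expr_order chi_w_prim; rewrite sqrf_eq1 => /predU1P[chi_w1|/eqP //].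
  by have := prim_order_dvd chi_w_prim 1; rewrite expr1 chi_w1 eqxx.
case: existsP => [[y /eqP yx]|x_nonsquare].
  by rewrite -yx ext_sqr //; apply: contraNneq x_neq0 => y0; rewrite -yx y0 expr0n.
have [k xE] := prim_rootP w_prim (expf_pred_card x_neq0).
have [odd_k|even_k] := boolP (odd k); first by rewrite xE extX // chi_w -signr_odd odd_k.
case: x_nonsquare; exists (w ^+ k./2); apply/eqP.
by rewrite -exprM muln2 even_halfK -?xE.
Qed.

Lemma natr2_neq0 : 2%:R != 0 :> F.
Proof. exact/dvdn_pred_card_natf_neq0/(lin_char_order_dvdn chi_lin). Qed.

Lemma card_sqr_roots x : #|[pred y : F | y ^+ 2 == x]|%:R = 1 + ext chi x.
Proof.
rewrite -qchar_ext /qchar; case: eqP => [->|/eqP x_neq0].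
  rewrite addr0 (eq_card (B := pred1 0)) ?card1 // => y; rewrite !inE.
  by rewrite expf_eq0.
case: existsP => [[y /eqP yx]|x_nonsquare]; last first.
  rewrite subrr eq_card0 // => y; rewrite inE.
  by apply/negP => yx; apply: x_nonsquare; exists y.
have y_neq0 : y != 0 by apply: contraNneq x_neq0 => y0; rewrite -yx y0 expr0n.
rewrite (eq_card (B := pred2 y (- y))) => [|z]; last by rewrite !inE -yx eqf_sqr.
rewrite card2 (_ : y != - y) // -subr_eq0 opprK -mulr2n -mulr_natl.
by rewrite mulf_neq0 ?natr2_neq0.
Qed.

Lemma Npts_quadratic d (a b : F) : (0 < d)%N ->
  (Npts d a b)%:R
    = #|F|%:R + (\sum_(x | x != 0) ext chi (x ^+ d + a * x + b) + ext chi b).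
Proof.
move=> d_gt0; pose f (x : F) := x ^+ d + a * x + b.
have -> : (Npts d a b)%:R = \sum_x (1 + ext chi (f x)).
  rewrite /Npts -sum1_card natr_sum.
  rewrite (eq_bigl (fun xy : F * F => xpredT xy.1 && (xy.2 ^+ 2 == f xy.1))); last first.
    by move=> xy; rewrite inE.
  rewrite -(pair_big_dep xpredT (fun x y => y ^+ 2 == f x) (fun _ _ => 1%:R)) /=.
  apply: eq_bigr => x _; rewrite -card_sqr_roots -sum1_card natr_sum.
  by apply: eq_bigl => y; rewrite inE.
rewrite big_split /= sumr_const; congr (_ + _).
rewrite (bigD1 0) //= addrC; congr (_ + ext chi _).
by rewrite /f expr0n gtn_eqF // mulr0 !add0r.
Qed.

End QuadraticCharacter.

Lemma eq_ghyp (F : finFieldType) n (A A' B B' : nat -> 'CF(UG F)) x :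
  A =1 A' -> B =1 B' -> ghyp n A B x = ghyp n A' B' x.
Proof.
move=> eqA eqB; rewrite /ghyp eqA; congr (_ * _); apply: eq_bigr => i _.
by congr (_ * _ * _); apply: eq_bigr => k _; rewrite eqA eqB.
Qed.

Lemma ghyp_prod (F : finFieldType) n (A B : nat -> 'CF(UG F)) x : B 0%N = 1 ->
  ghyp n A B x = #|F|%:R / #|F|.-1%:R * \sum_(i : Iirr (UG F))
    (\prod_(k < n.+1) gbinom (A k * 'chi_i) (B k * 'chi_i)) * ext 'chi_i x.
Proof.
move=> B0; congr (_ * _); apply: eq_bigr => i _.
by rewrite big_ord_recl B0 mul1r big_add1 big_mkord.
Qed.

(** * Products of Gauss sums *)

Lemma exp_mul_prim_root (R : nzRingType) (z : R) m n :
  (m * n).-primitive_root z -> n.-primitive_root (z ^+ m).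
Proof.
move=> z_prim; have := dvdn_prim_root z_prim (dvdn_mull m (dvdnn n)).
by rewrite mulnK //; move: (prim_order_gt0 z_prim); rewrite muln_gt0 => /andP[].
Qed.

Lemma eq_odd_prim_root_expr (R : nzRingType) (z : R) m i j :
  (2 * m).-primitive_root z -> z ^+ i = z ^+ j -> odd i = odd j.
Proof.
move=> z_prim /eqP; rewrite (eq_prim_root_expr z_prim) => /eqP/(congr1 (modn^~ 2)).
by rewrite !modn_dvdm ?dvdn_mulr // !modn2; do 2!case: odd.
Qed.

Section GaussProducts.
Variables (F : finFieldType) (theta : 'CF([set: F])).
Hypotheses (theta_lin : theta \is a linear_char) (theta_neq1 : theta != 1).
Implicit Types (chi psi rho : 'CF(UG F)).

Local Notation q := #|F|.
Local Notation gauss := (gauss theta).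

Lemma invr_gauss chi : chi \is a linear_char ->
  (gauss chi)^-1 = (ext chi (-1) * gauss chi^-1 - q.-1%:R *+ (chi == 1)) / q%:R.
Proof.
move=> chi_lin; have q_neq0 := card_finField_neq0 F.
have gauss_chi_neq0 := gauss_neq0 theta_lin theta_neq1 chi_lin.
apply: (mulfI gauss_chi_neq0); rewrite divff //; case: eqP => [->|/eqP chi_neq1].
  rewrite invr1 gauss1 // ext_cfun1 oppr1_neq0 mulr1n mul1r mulN1r -mulNr opprB opprK.
  by rewrite natr1 -card_finField_succ divff.
rewrite mulr0n subr0 mulrA mulrCA gauss_mulV // mulrA -expr2 ext_sqr_neg1 //.
by rewrite mul1r divff.
Qed.

Lemma prod_gauss_odd_order r n rho : n = (2 * r)%N ->
    rho \is a linear_char -> n.+1.-primitive_root rho ->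
  \prod_(i < n) gauss (rho ^+ i.+1) = q%:R ^+ r.
Proof.
move=> nE rho_lin rho_prim.
have rho_neg1 i : ext (rho ^+ i.+1) (-1) = 1.
  have -> : rho ^+ i.+1 = rho ^+ (i.+1 * n.+2).
    by rewrite mulnS exprD mulnC exprM (prim_expr_order rho_prim) expr1n mulr1.
  by rewrite ext_even_neg1 // oddM /= nE oddM andbF.
rewrite (prod_gauss_symmetric theta_lin theta_neq1 (f := fun i => rho ^+ i.+1) nE).
  by rewrite big1 ?mul1r.
move=> i lt_ir; split; first by rewrite rpredX.
  by rewrite -(prim_order_dvd rho_prim) gtnNdvd //; lia.
by rewrite -exprD -(prim_expr_order rho_prim); congr (_ ^+ _); lia.
Qed.

Lemma prod_gauss_even_order r n rho : n = (2 * r.+1)%N ->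
    rho \is a linear_char -> n.-primitive_root rho -> ext rho (-1) = 1 ->
  \prod_(i < n.-1) gauss (rho ^+ i.+1) = q%:R ^+ r * gauss (rho ^+ r.+1).
Proof.
move=> nE rho_lin rho_prim rho_neg1; pose f i := rho ^+ (bump r i).+1.
have -> : n.-1 = (2 * r).+1 by lia.
have lt_r : (r < (2 * r).+1)%N by lia.
rewrite (bigD1_ord (Ordinal lt_r)) //= mulrC; congr (_ * _).
rewrite (prod_gauss_symmetric theta_lin theta_neq1 (f := f) (erefl _)).
  rewrite big1 ?mul1r // => i _.
  by rewrite /f ext_cfunX ?oppr1_neq0 // rho_neg1 expr1n.
move=> i lt_ir; split; first by rewrite rpredX.
  by rewrite -(prim_order_dvd rho_prim) gtnNdvd // /bump; lia.
by rewrite -exprD -(prim_expr_order rho_prim); congr (_ ^+ _); rewrite /bump; lia.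
Qed.

Lemma ext_odd_neg1 chi k : chi \is a linear_char -> odd k ->
  ext (chi ^+ k) (-1) = ext chi (-1).
Proof.
move=> chi_lin odd_k; rewrite -(odd_double_half k) odd_k exprS ext_cfunM.
by rewrite ext_even_neg1 ?odd_double // mulr1.
Qed.

Lemma gauss_quadratic_sqr chi : chi \is a linear_char -> 2.-primitive_root chi ->
  ext chi (-1) = 1 -> gauss chi ^+ 2 = q%:R.
Proof.
move=> chi_lin chi_prim chi_neg1.
have chi_neq1 : chi != 1 by rewrite -[chi]expr1 -(prim_order_dvd chi_prim).
by rewrite expr2 -{2}(mulr1_eq (prim_expr_order chi_prim)) gauss_mulV // chi_neg1 mul1r.
Qed.

Lemma quadratic_ext_natr r n psi : n = (2 * r.+1)%N ->
    psi \is a linear_char -> (2 * n).-primitive_root psi ->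
  ext (psi ^+ n) n%:R = ext psi (-1) ^+ r.+1.
Proof.
move=> nE psi_lin psi_prim; have q_neq0 := card_finField_neq0 F.
have rho_prim : n.-primitive_root (psi ^+ 2) := exp_mul_prim_root psi_prim.
have phi_prim : 2.-primitive_root (psi ^+ n) by apply: exp_mul_prim_root; rewrite mulnC.
have even_n : ~~ odd n by rewrite nE oddM.
have := hasse_davenport theta_lin theta_neq1 _ rho_prim psi_lin.
rewrite (prod_gauss_even_order nE) ?rpredX ?ext_even_neg1 // -exprM -nE => /(_ isT).
under eq_bigr => i _ do rewrite -exprM -exprSr.
rewrite (prod_gauss_symmetric theta_lin theta_neq1 (f := fun i => psi ^+ (2 * i).+1) nE);
    last first.
  move=> i lt_ir; split; first by rewrite rpredX.
    apply/eqP => /(eq_odd_prim_root_expr (j := 0) psi_prim).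
    by rewrite /= mul2n odd_double.
  by rewrite -exprD -(prim_expr_order psi_prim); congr (_ ^+ _); lia.
under eq_bigr => i _ do rewrite ext_odd_neg1 //= ?mul2n ?odd_double //.
rewrite prodr_const card_ord mulrACA -expr2 gauss_quadratic_sqr ?rpredX ?ext_even_neg1 //.
rewrite -mulrA -exprSr => /(mulIf (expf_neq0 _ q_neq0)) psi_neg1E.
by rewrite -[LHS]invrK -psi_neg1E -exprVn (mulr1_eq (ext_sqr_neg1 psi_lin)).
Qed.

End GaussProducts.

(** * The hypergeometric series *)

Section TrinomialHypergeometric.
Variables (F : finFieldType) (theta : 'CF([set: F])).
Hypotheses (theta_lin : theta \is a linear_char) (theta_neq1 : theta != 1).
Variables (r n : nat) (xi : 'CF(UG F)).

Local Notation q := #|F|.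
Local Notation gauss := (gauss theta).
Local Notation d := n.+1.

Hypothesis nE : n = (2 * r.+1)%N.
Hypotheses (xi_lin : xi \is a linear_char) (xi_prim : (2 * d * n).-primitive_root xi).
Implicit Types (chi lam : 'CF(UG F)).

Definition xi_top k := xi ^+ (2 * k.+1 * n - d).
Local Notation psi := (xi ^+ d).
Local Notation phi := (psi ^+ n).
Definition xi_bottom k := psi ^+ (2 * k).

Let q_neq0 : q%:R != 0 :> algC := card_finField_neq0 F.
Let neg1_neq0 : -1 != 0 :> F := oppr1_neq0 F.
Let even_n : ~~ odd n.
Proof. by rewrite nE oddM. Qed.

Lemma psi_lin : psi \is a linear_char.
Proof. by rewrite rpredX. Qed.

Lemma natr_n_neq0 : n%:R != 0 :> F.
Proof.
apply/dvdn_pred_card_natf_neq0/(dvdn_trans _ (lin_char_order_dvdn xi_lin xi_prim)).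
by rewrite dvdn_mull.
Qed.

Lemma natr_d_neq0 : d%:R != 0 :> F.
Proof.
apply/dvdn_pred_card_natf_neq0/(dvdn_trans _ (lin_char_order_dvdn xi_lin xi_prim)).
by rewrite dvdn_mulr ?dvdn_mull.
Qed.

Lemma xi_top_lin k : xi_top k \is a linear_char.
Proof. by rewrite rpredX. Qed.

Lemma xi_bottom_lin k : xi_bottom k \is a linear_char.
Proof. by rewrite rpredX ?psi_lin. Qed.

Lemma psi_prim : (2 * n).-primitive_root psi.
Proof. by apply: exp_mul_prim_root; rewrite mulnCA mulnA. Qed.

Lemma phi_prim : 2.-primitive_root phi.
Proof. by apply: exp_mul_prim_root; rewrite mulnC psi_prim. Qed.

Let phi_neq1 : phi != 1.
Proof. by rewrite -[phi]expr1 -(prim_order_dvd phi_prim). Qed.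

Let phi_sqr : phi ^+ 2 = 1 := prim_expr_order phi_prim.

Lemma phi_lin : phi \is a linear_char.
Proof. by rewrite rpredX ?psi_lin. Qed.

Lemma phi_neg1 : ext phi (-1) = 1.
Proof. by rewrite ext_even_neg1 ?psi_lin. Qed.

Lemma phi_natr : ext phi n%:R = ext xi (-1) ^+ r.+1.
Proof.
by rewrite (quadratic_ext_natr theta_lin theta_neq1 nE psi_lin psi_prim) ext_odd_neg1.
Qed.

Lemma xi_top_mul_psi k : xi_top k * psi = (xi ^+ (2 * n)) ^+ k.+1.
Proof. by rewrite -exprD -exprM; congr (_ ^+ _); lia. Qed.

Lemma xi_bottom_neg1 k : ext (xi_bottom k) (-1) = 1.
Proof. by rewrite ext_even_neg1 ?psi_lin // oddM. Qed.

Lemma odd_xi_top k : odd (2 * k.+1 * n - d).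
Proof. by rewrite oddB ?oddM //; nia. Qed.

Lemma xi_top_div_neg1 k : ext (xi_top k * (xi_bottom k)^-1) (-1) = ext xi (-1).
Proof.
rewrite ext_cfunM ext_cfunV ?rpredX // xi_bottom_neg1 invr1 mulr1.
by rewrite ext_odd_neg1 ?odd_xi_top.
Qed.

Lemma xi_top_div_neq1 k : xi_top k * (xi_bottom k)^-1 != 1.
Proof.
have bottom_unit : xi_bottom k \is a GRing.unit by rewrite lin_char_unitr ?rpredX.
rewrite -(inj_eq (mulIr bottom_unit)) mulrVK // mul1r; apply/eqP.
have order_xi : (2 * (d * n)).-primitive_root xi by rewrite mulnA.
rewrite /xi_bottom -exprM => /(eq_odd_prim_root_expr order_xi).
by rewrite odd_xi_top !oddM andbF.
Qed.

Lemma xi_top_div_mirror i j : (i + j).+1 = n ->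
  (xi_top i * (xi_bottom i)^-1) * (xi_top j * (xi_bottom j)^-1) = 1.
Proof.
move=> ij_n.
have bottom_unit k : xi_bottom k \is a GRing.unit by rewrite lin_char_unitr ?rpredX.
have bottom_psi : xi_bottom j * xi_bottom i * psi ^+ 2 = 1.
  by rewrite /xi_bottom -!exprD -[RHS](prim_expr_order psi_prim); congr (_ ^+ _); lia.
rewrite mulrACA -invrM // (mulr1_eq bottom_psi) expr2 mulrACA !xi_top_mul_psi -exprD.
have -> : (i.+1 + j.+1 = d)%N by lia.
by rewrite -exprM mulnAC prim_expr_order.
Qed.

Lemma prod_gauss_xi_top_div :
  \prod_(k < n) gauss (xi_top k * (xi_bottom k)^-1) = ext xi (-1) ^+ r.+1 * q%:R ^+ r.+1.
Proof.
rewrite (prod_gauss_symmetric theta_lin theta_neq1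
  (f := fun k => xi_top k * (xi_bottom k)^-1) nE) => [|k lt_k].
  by under eq_bigr => k _ do rewrite xi_top_div_neg1; rewrite prodr_const card_ord.
split; [by rewrite rpred_div ?rpredX | exact: xi_top_div_neq1 |].
by apply: xi_top_div_mirror; lia.
Qed.

Lemma prod_gauss_xi_top lam : lam \is a linear_char ->
  \prod_(k < n) gauss (xi_top k * (psi * lam))
    = (ext (lam ^+ d) d%:R)^-1 * gauss (lam ^+ d) * q%:R ^+ r.+1 / gauss lam.
Proof.
move=> lam_lin; have rho_lin : xi ^+ (2 * n) \is a linear_char by rewrite rpredX.
have rho_prim : d.-primitive_root (xi ^+ (2 * n)).
  by apply: exp_mul_prim_root; rewrite mulnAC.
have gauss_lam_neq0 := gauss_neq0 theta_lin theta_neq1 lam_lin.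
rewrite -(prod_gauss_odd_order theta_lin theta_neq1 nE rho_lin rho_prim).
rewrite -(hasse_davenport theta_lin theta_neq1 rho_lin rho_prim lam_lin).
rewrite [X in _ = X / _]big_ord_recl mul1r [RHS]mulrC mulKf //; apply: eq_bigr => k _.
by rewrite mulrA xi_top_mul_psi.
Qed.

Lemma prod_gauss_xi_bottom chi : chi \is a linear_char ->
  \prod_(k < n) gauss (xi_bottom k * chi)^-1
    = ext (chi ^+ n) n%:R * gauss (chi ^- n) * (q%:R ^+ r * gauss phi).
Proof.
move=> chi_lin; set rho := psi ^+ 2; pose rhoV := rho ^+ n.-1.
have rho_prim : n.-primitive_root rho := exp_mul_prim_root psi_prim.
have rhoVE : rho^-1 = rhoV.
  by apply: mulr1_eq; rewrite -exprS prednK ?(prim_order_gt0 rho_prim) // prim_expr_order.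
have rhoV_lin : rhoV \is a linear_char by rewrite !rpredX.
have rhoV_prim : n.-primitive_root rhoV.
  by rewrite prim_root_exp_coprime // coprimePn // (prim_order_gt0 rho_prim).
have rhoV_neg1 : ext rhoV (-1) = 1 by rewrite /rhoV exprAC ext_even_neg1 ?rpredX.
have chiV_lin : chi^-1 \is a linear_char by rewrite rpredV.
have := hasse_davenport theta_lin theta_neq1 rhoV_lin rhoV_prim chiV_lin.
rewrite (prod_gauss_even_order _ _ nE) // exprVn ext_cfunV ?rpredX // invrK.
have -> : rhoV ^+ r.+1 = phi.
  by rewrite -rhoVE exprVn -[rho ^+ _]exprM -nE (mulr1_eq phi_sqr).
move=> <-; apply: eq_bigr => k _; rewrite -rhoVE exprVn -[rho ^+ _]exprM.
by rewrite invrM ?lin_char_unitr ?rpredX // mulrC.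
Qed.

Lemma prod_gbinom_xi lam : lam \is a linear_char ->
  \prod_(k < n) gbinom (xi_top k * (psi * lam)) (xi_bottom k * (psi * lam))
    = q%:R ^- r.+2 * gauss phi * ext lam (n%:R ^+ n / d%:R ^+ d)
      * (gauss (phi * lam ^- n) * gauss (lam ^+ d) / gauss lam).
Proof.
move=> lam_lin; set chi := psi * lam.
have chi_lin : chi \is a linear_char by rewrite rpredM ?psi_lin.
have factorE (k : 'I_n) : gbinom (xi_top k * chi) (xi_bottom k * chi)
    = ext chi (-1) / q%:R * gauss (xi_top k * chi) * gauss (xi_bottom k * chi)^-1
      / gauss (xi_top k * (xi_bottom k)^-1).
  have divE : xi_top k * chi * (xi_bottom k * chi)^-1 = xi_top k * (xi_bottom k)^-1.
    by rewrite invrM ?lin_char_unitr ?rpredX // mulrA mulrK // lin_char_unitr.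
  have div_neq1 : xi_top k * chi * (xi_bottom k * chi)^-1 != 1.
    by rewrite divE xi_top_div_neq1.
  rewrite (gbinom_gauss theta_lin theta_neq1 (rpredM (xi_top_lin k) chi_lin)
    (rpredM (xi_bottom_lin k) chi_lin) div_neq1) divE.
  by rewrite ext_cfunM xi_bottom_neg1 mul1r !mulrA.
rewrite (eq_bigr _ (fun k _ => factorE k)) !big_split /= !prodfV.
rewrite prod_gauss_xi_top_div prod_gauss_xi_top // prod_gauss_xi_bottom //.
have q_n : q%:R ^+ n = q%:R ^+ r.+2 * q%:R ^+ r :> algC.
  by rewrite nE mul2n -addnn addSnnS exprD mulrC.
have chi_n : chi ^+ n = phi * lam ^+ n by rewrite exprMn.
have chi_Vn : chi ^- n = phi * lam ^- n.
  by rewrite chi_n invrM ?lin_char_unitr ?rpredX // (mulr1_eq phi_sqr) mulrC.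
rewrite !prodr_const card_ord -ext_cfunX // ext_even_neg1 // q_n chi_Vn chi_n ext_cfunM.
rewrite phi_natr extM // extV // !extX // !ext_cfunX ?natr_n_neq0 ?natr_d_neq0 //.
field.
by rewrite !expf_neq0 ?ext_neq0 ?natr_d_neq0 // gauss_neq0.
Qed.

Section Evaluation.
Variables a b : F.
Hypotheses (a_neq0 : a != 0) (b_neq0 : b != 0).

Definition trinomial_alpha : F := d%:R / a * (d%:R * b / (a * n%:R)) ^+ n.
Local Notation alpha := trinomial_alpha.
Local Notation t := (b ^+ n / a ^+ d).

Lemma trinomial_alpha_neq0 : alpha != 0.
Proof.
have d_neq0 := natr_d_neq0; have n_neq0 := natr_n_neq0.
by apply: mulf_neq0; [|apply: expf_neq0]; rewrite mulf_neq0 ?invr_neq0 ?mulf_neq0.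
Qed.

Lemma trinomial_alphaE : alpha * (n%:R ^+ n / d%:R ^+ d) = t.
Proof.
rewrite /trinomial_alpha expr_div_n !exprMn !exprS; field.
by rewrite nat1r a_neq0 !expf_neq0 ?natr_d_neq0 ?natr_n_neq0.
Qed.

Lemma xi_ghyp_term lam : lam \is a linear_char ->
  ext psi (- alpha^-1)
    * (\prod_(k < n) gbinom (xi_top k * (psi * lam)) (xi_bottom k * (psi * lam))
       * ext (psi * lam) (- alpha))
  = q%:R ^- r.+2 * gauss phi
    * (ext lam (- t) * (gauss (phi * lam ^- n) * gauss (lam ^+ d) / gauss lam)).
Proof.
move=> lam_lin; rewrite prod_gbinom_xi // -trinomial_alphaE.
rewrite -[- (alpha * _)]mulNr [ext lam (- alpha * _)]extM // ext_cfunM.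
rewrite -invrN extV ?psi_lin //.
have psi_alpha_neq0 : ext psi (- alpha) != 0.
  by rewrite ext_neq0 ?psi_lin // oppr_eq0 trinomial_alpha_neq0.
field.
by rewrite psi_alpha_neq0 gauss_neq0 // expf_neq0.
Qed.

Local Notation trinomial_sum := (\sum_(x | x != 0) ext phi (x ^+ d + a * x + b)).

Lemma sum_xi_ghyp_term :
  \sum_(i : Iirr (UG F)) ext 'chi_i (- t)
      * (gauss (phi * ('chi_i ^+ n)^-1) * gauss ('chi_i ^+ d) / gauss 'chi_i)
    = q.-1%:R / q%:R * gauss phi * (ext phi b * trinomial_sum + 1).
Proof.
have phiV : phi^-1 = phi := mulr1_eq phi_sqr.
have b_sqr : ext phi b * ext phi b = 1.
  by rewrite -ext_cfunM -expr2 phi_sqr ext_cfun1 b_neq0.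
have sumE : \sum_(i : Iirr (UG F)) ext 'chi_i t * gauss_triple theta phi n d 'chi_i
    = ext phi b * (q.-1%:R * (gauss phi * trinomial_sum)).
  have := trinomial_sum_gauss theta_lin n phi_lin phi_neq1 a_neq0 b_neq0.
  by rewrite phiV => ->; rewrite mulrA b_sqr mul1r.
transitivity ((\sum_(i : Iirr (UG F)) ext 'chi_i t * gauss_triple theta phi n d 'chi_i
   + q.-1%:R * gauss phi) / q%:R); last by rewrite sumE; ring.
have t_neq0 : t != 0 by rewrite mulf_neq0 ?invr_neq0 ?expf_neq0.
rewrite (bigD1 0) //= [in RHS](bigD1 0) //= irr0 [in RHS]addrAC mulrDl.
rewrite [X in _ = _ + X]mulr_suml; congr (_ + _).
  rewrite /gauss_triple !expr1n invr1 [phi * 1]mulr1 gauss1 //.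
  rewrite !ext_cfun1 oppr_eq0 t_neq0 !mul1r.
  have q_succ : q%:R = q.-1%:R + 1 :> algC by rewrite natr1 -card_finField_succ.
  by have := q_neq0; rewrite q_succ => N_succ_neq0; field.
apply: eq_bigr => i i_neq0; have chi_lin := irr_UG_lin i.
rewrite invr_gauss // irr_eq1 (negbTE i_neq0) mulr0n subr0 /gauss_triple.
rewrite -[- t]mulN1r [ext _ (-1 * t)]extM // -[RHS]mul1r.
by rewrite -[X in _ = X * _](ext_sqr_neg1 chi_lin); ring.
Qed.

Lemma ext_psi_ghyp_series :
  ext psi (- alpha^-1)
    * \sum_(i : Iirr (UG F))
        (\prod_(k < n) gbinom (xi_top k * 'chi_i) (xi_bottom k * 'chi_i))
        * ext 'chi_i (- alpha)
  = q.-1%:R / q%:R * (q%:R ^- r.+1 * (ext phi b * trinomial_sum + 1)).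
Proof.
pose term chi :=
  (\prod_(k < n) gbinom (xi_top k * chi) (xi_bottom k * chi)) * ext chi (- alpha).
rewrite -[X in _ * X](sum_irr_mul_lin term psi_lin) mulr_sumr.
under eq_bigr => i _ do rewrite /term xi_ghyp_term ?irr_UG_lin //.
rewrite -mulr_sumr sum_xi_ghyp_term.
have := gauss_quadratic_sqr theta_lin theta_neq1 phi_lin phi_prim phi_neg1.
have qr_neq0 : q%:R ^+ r.+1 != 0 :> algC by rewrite expf_neq0.
rewrite [q%:R ^+ r.+2]exprS; move: (ext phi b * _ + 1) (gauss phi) => S g g_sqr.
transitivity (q.-1%:R * g ^+ 2 * S / (q%:R * q%:R ^+ r.+1 * q%:R)).
  by field; rewrite q_neq0.
by rewrite g_sqr; field; rewrite qr_neq0 q_neq0.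
Qed.

Let correction : algC := ext phi (- (b * n%:R)) * ext (psi ^+ r.+1) (-1).

Lemma correctionE : correction = ext phi b.
Proof.
rewrite /correction -[- (b * _)]mulN1r !extM ?phi_lin // phi_neg1 mul1r phi_natr.
rewrite [ext (psi ^+ r.+1) _]ext_cfunX // [ext psi (-1)]ext_odd_neg1 //.
by rewrite -mulrA -exprMn -expr2 ext_sqr_neg1 // expr1n mulr1.
Qed.

Theorem Npts_ghyp :
  (Npts d a b)%:R = q%:R + ext phi b - correction
    + q%:R ^+ r.+1 * correction * ext psi (- alpha^-1)
      * ghyp n.-1 xi_top xi_bottom (- alpha).
Proof.
have qr_neq0 : q%:R ^+ r.+1 != 0 :> algC by rewrite expf_neq0.
have pred_q_neq0 : q.-1%:R != 0 :> algC by rewrite pnatr_eq0 -lt0n pred_card_gt0.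
have phi_b_sqr : ext phi b ^+ 2 = 1.
  by rewrite -ext_cfunX // phi_sqr ext_cfun1 b_neq0.
rewrite correctionE addrK (Npts_quadratic phi_lin phi_prim a b) //; congr (_ + _).
rewrite ghyp_prod; last by rewrite /xi_bottom muln0 expr0.
rewrite [n.-1.+1]prednK ?nE // -nE -[RHS]mulrA [X in _ = _ * X]mulrCA.
rewrite ext_psi_ghyp_series.
transitivity (ext phi b ^+ 2 * trinomial_sum + ext phi b).
  by rewrite phi_b_sqr mul1r.
field.
by rewrite qr_neq0 q_neq0 pred_q_neq0.
Qed.

End Evaluation.
End TrinomialHypergeometric.

Lemma irr_generator_prim_root (F : finFieldType) (t : Iirr (UG F)) :
    (forall i : Iirr (UG F), exists k : nat, 'chi_i = 'chi_t ^+ k) ->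
  #|F|.-1.-primitive_root 'chi_t.
Proof.
move=> t_gen; have t_lin := irr_UG_lin t.
have [m t_prim m_dvd] :=
  prim_order_exists (pred_card_gt0 F) (lin_char_expr_pred_card t_lin).
suff le_m : (#|F|.-1 <= m)%N.
  suff -> : #|F|.-1 = m by [].
  by apply/eqP; rewrite eqn_leq le_m dvdn_leq ?pred_card_gt0.
have exp_lt i : exists k : 'I_m, 'chi_i == 'chi_t ^+ k.
  have [k ->] := t_gen i; exists (Ordinal (ltn_pmod k (prim_order_gt0 t_prim))).
  by rewrite /= (prim_expr_mod t_prim).
have inj_log : injective (fun i => xchoose (exp_lt i)).
  move=> i j eq_ij; apply: irr_inj.
  by rewrite (eqP (xchooseP (exp_lt i))) eq_ij -(eqP (xchooseP (exp_lt j))).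
have := leq_card _ inj_log.
by rewrite card_Iirr_abelian ?abelian_UG // card_finField_unit card_ord.
Qed.

Lemma quotient_exponents r n e (N := (e * (2 * n.+1 * n))%N) : n = (2 * r.+1)%N ->
  [/\ N %/ (2 * n.+1 * n) = e, N %/ (2 * n) = e * n.+1 & N %/ 4 = e * n.+1 * r.+1]%N.
Proof.
move=> nE; have n_gt0 : (0 < n)%N by rewrite nE.
split; rewrite /N; first by rewrite mulnK // !muln_gt0 n_gt0.
  by rewrite -(mulnA 2) (mulnCA 2) mulnA mulnK // muln_gt0 n_gt0.
have -> : (e * (2 * n.+1 * n) = e * n.+1 * r.+1 * 4)%N by rewrite {2}nE; ring.
by rewrite mulnK.
Qed.

Theorem theorem1p2 (F : finFieldType) (d : nat) (a b : F) (t : Iirr (UG F)) :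
  odd d -> (3 <= d)%N ->
  (#|F| == 1 %[mod 2 * d * (d - 1)])%N ->
  a != 0 -> b != 0 ->
  (forall i : Iirr (UG F), exists k : nat, 'chi_i = 'chi_t ^+ k) ->
  let q := #|F| in
  let T := 'chi_t in
  let psi := T ^+ ((q - 1) %/ (2 * (d - 1))) in
  let xi := T ^+ ((q - 1) %/ (2 * d * (d - 1))) in
  let alpha : F := d%:R / a * (d%:R * b / (a * (d - 1)%:R)) ^+ (d - 1) in
  let A := fun k : nat =>
    if k == 0%N then xi ^+ (d - 2) else xi ^+ (2 * k.+1 * (d - 1) - d) in
  let B := fun k : nat => psi ^+ (2 * k) in
  let c := qchar (- (b * (d - 1)%:R)) * ext (T ^+ ((q - 1) %/ 4)) (-1) in
  (Npts d a b)%:R =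
    q%:R + qchar b - c
    + (q ^ ((d - 1) %/ 2))%:R * c
      * ext (T ^+ ((q - 1) %/ (2 * (d - 1)))) (- alpha^-1)
      * ghyp (d - 2) A B (- alpha).
Proof.
case: d => // n even_n n_gt1; rewrite (subSS 1) subSS subn0 => q_mod a_neq0 b_neq0.
move=> /irr_generator_prim_root T_prim q T; rewrite !subn1.
have [theta theta_lin theta_neq1] := exists_addchar F.
have [r nE] : exists r, n = (2 * r.+1)%N by exists (n./2).-1; lia.
have [e qE] : exists e, q.-1 = (e * (2 * n.+1 * n))%N.
  by apply/dvdnP; rewrite -subn1 -eqn_mod_dvd // ltnW ?finNzRing_gt1.
have [div_xi div_psi div_4] := quotient_exponents e nE.
rewrite qE div_xi div_psi div_4 !exprM => psi xi alpha A B c.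
have xi_lin : xi \is a linear_char by rewrite rpredX ?irr_UG_lin.
have xi_prim : (2 * n.+1 * n).-primitive_root xi.
  by apply: exp_mul_prim_root; rewrite -qE.
have phiE := qchar_ext (phi_lin n xi_lin) (phi_prim xi_prim).
have half_n : (n %/ 2 = r.+1)%N by rewrite nE mulKn.
have AE k : A k = xi_top n xi k.
  by rewrite /A /xi_top; case: k => [|k] //=; congr (xi ^+ _); clear -nE; lia.
rewrite (eq_ghyp _ _ AE (B' := xi_bottom n xi)) // /c !phiE natrX half_n.
exact: (Npts_ghyp theta_lin theta_neq1 nE).
Qed.
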